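(* Let $E/\mathbb{Q}$ be an elliptic curve of Mordell--Weil rank $r>0$. Let $\lambda_1\le\cdots\le\lambda_r$ be the successive minima of $M_E=E(\mathbb{Q})/E(\mathbb{Q})_{\mathrm{tors}}$ with respect to the norm $\|P\|^2=\widehat h_E(P)$, and let $\kappa_r=\pi^{r/2}/\Gamma(r/2+1)$ be the volume of the unit ball in $\mathbb{R}^r$. Then $$\frac{2^r}{r!\,\kappa_r}\sqrt{\operatorname{Reg}(E/\mathbb{Q})}\le\prod_{i=1}^r\lambda_i\le\frac{2^r}{\kappa_r}\sqrt{\operatorname{Reg}(E/\mathbb{Q})}.$$ Equivalently, $$\left(\frac{\kappa_r}{2^r}\right)^2\prod_{i=1}^r\lambda_i^2\le\operatorname{Reg}(E/\mathbb{Q})\le\left(\frac{r!\,\kappa_r}{2^r}\right)^2\prod_{i=1}^r\lambda_i^2.$$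
   Context: For an elliptic curve $E/\mathbb{Q}$, $M_E:=E(\mathbb{Q})/E(\mathbb{Q})_{\mathrm{tors}}$ is free abelian of finite rank $r$. $\widehat h_E$ is the canonical (N\'eron--Tate) height in the Cremona/PARI normalization, i.e. $\widehat h_E(P)=\lim_{n\to\infty}4^{-n}h(x(2^nP))$ with $h$ the logarithmic Weil height on $\mathbb{P}^1(\mathbb{Q})$ (twice the height in Silverman's normalization). The pairing $\langle P,Q\rangle_E=\frac12(\widehat h_E(P+Q)-\widehat h_E(P)-\widehat h_E(Q))$ descends to $M_E$ and extends $\mathbb{R}$-bilinearly to a positive-definite inner product on $V_E:=M_E\otimes_{\mathbb{Z}}\mathbb{R}$, with norm $\|\cdot\|$. The regulator is $\operatorname{Reg}(E/\mathbb{Q}):=\det(\langle P_i,P_j\rangle_E)$ for any basis $P_1,\dots,P_r$ of $M_E$. The $i$-th successive minimum $\lambda_i$ is the least $\lambda$ such that the closed ball of radius $\lambda$ in $(V_E,\|\cdot\|)$ contains $i$ linearly independent vectors of $M_E$. *)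

(* Defs.v *)
From HB Require Import structures.
From mathcomp Require Import all_boot all_order all_algebra.
From mathcomp Require Import ring.
From mathcomp Require Import all_classical all_reals all_analysis.
Import Order.TTheory GRing.Theory Num.Theory.
Import numFieldNormedType.Exports.

Set Implicit Arguments.
Unset Strict Implicit.
Unset Printing Implicit Defensive.

Local Open Scope classical_set_scope.
Local Open Scope ring_scope.

(** * Elliptic curves over Q and their rational points *)

(* y^2 + a1 x y + a3 y = x^3 + a2 x^2 + a4 x + a6 *)
Record weierstrass := Weierstrass
  { wa1 : rat; wa2 : rat; wa3 : rat; wa4 : rat; wa6 : rat }.

Section Discriminant.
Variable W : weierstrass.

Definition wb2 := wa1 W ^+ 2 + 4 * wa2 W.
Definition wb4 := 2 * wa4 W + wa1 W * wa3 W.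
Definition wb6 := wa3 W ^+ 2 + 4 * wa6 W.
Definition wb8 := wa1 W ^+ 2 * wa6 W + 4 * wa2 W * wa6 W
  - wa1 W * wa3 W * wa4 W + wa2 W * wa3 W ^+ 2 - wa4 W ^+ 2.
Definition wdisc :=
  - wb2 ^+ 2 * wb8 - 8 * wb4 ^+ 3 - 27 * wb6 ^+ 2 + 9 * wb2 * wb4 * wb6.

End Discriminant.

Record elliptic_curve := EllipticCurve
  { ec_model :> weierstrass; ec_smooth : wdisc ec_model != 0 }.

Section Points.
Variable E : elliptic_curve.
Local Notation a1 := (wa1 E).
Local Notation a2 := (wa2 E).
Local Notation a3 := (wa3 E).
Local Notation a4 := (wa4 E).
Local Notation a6 := (wa6 E).

(* [None] is the point at infinity. *)
Definition on_curve (p : option (rat * rat)) : bool :=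
  if p is Some (x, y) then
    y ^+ 2 + a1 * x * y + a3 * y == x ^+ 3 + a2 * x ^+ 2 + a4 * x + a6
  else true.

Definition raw_opp (p : option (rat * rat)) : option (rat * rat) :=
  if p is Some (x, y) then Some (x, - y - a1 * x - a3) else None.

(* Slope of the chord through two points, or of the tangent when their
   abscissae agree and they are not opposite. *)
Definition ec_slope (x1 y1 x2 y2 : rat) : rat :=
  if x1 == x2 then
    (3 * x1 ^+ 2 + 2 * a2 * x1 + a4 - a1 * y1) / (2 * y1 + a1 * x1 + a3)
  else (y2 - y1) / (x2 - x1).

Definition raw_add (p q : option (rat * rat)) : option (rat * rat) :=
  match p, q with
  | None, _ => q
  | _, None => p
  | Some (x1, y1), Some (x2, y2) =>
      if (x1 == x2) && (y2 == - y1 - a1 * x1 - a3) then None else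
      let l := ec_slope x1 y1 x2 y2 in
      let x3 := l ^+ 2 + a1 * l - a2 - x1 - x2 in
      Some (x3, l * (x1 - x3) - y1 - a1 * x3 - a3)
  end.

Lemma raw_opp_on p : on_curve p -> on_curve (raw_opp p).
Proof.
case: p => [[x y]|] //= /eqP H; apply/eqP; rewrite -H; ring.
Qed.

Lemma raw_add_on p q : on_curve p -> on_curve q -> on_curve (raw_add p q).
Proof.
case: p q => [[x1 y1]|] [[x2 y2]|] //= /eqP H1 /eqP H2.
case: ifPn => // Hne; rewrite /on_curve; set l := ec_slope _ _ _ _.
(* the line y = y1 + l (x - x1) meets the curve at the abscissae x1 and x2 *)
have [k1 k2] : y2 = y1 + l * (x2 - x1) /\
   l * (2 * y1 + l * (x2 - x1) + a1 * x2 + a3) + a1 * y1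
     = x1 ^+ 2 + x1 * x2 + x2 ^+ 2 + a2 * (x1 + x2) + a4.
  rewrite /l /ec_slope; case: eqP Hne => [e|/eqP ne] /= Hne; last first.
    have d0 : x2 - x1 != 0 by rewrite subr_eq0 eq_sym.
    have e1 : y2 = y1 + (y2 - y1) / (x2 - x1) * (x2 - x1) by rewrite divfK //; ring.
    split=> //; set l' := _ / _ in e1 *; apply: (mulfI d0).
    have : (y2 ^+ 2 + a1 * x2 * y2 + a3 * y2) - (y1 ^+ 2 + a1 * x1 * y1 + a3 * y1)
      = (x2 ^+ 3 + a2 * x2 ^+ 2 + a4 * x2 + a6)
        - (x1 ^+ 3 + a2 * x1 ^+ 2 + a4 * x1 + a6) by rewrite H1 H2.
    rewrite e1 => /eqP; rewrite -subr_eq0 => /eqP h.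
    apply/eqP; rewrite -subr_eq0; apply/eqP; rewrite -[RHS]h; ring.
  rewrite -e in H2 *.
  have : (y2 - y1) * (y2 - (- y1 - a1 * x1 - a3)) = 0.
    rewrite -[RHS](subrr (x1 ^+ 3 + a2 * x1 ^+ 2 + a4 * x1 + a6)) -{1}H2 -H1; ring.
  move/eqP; rewrite mulf_eq0 (subr_eq0 y2 (- _ - _ - _)) (negbTE Hne) orbF subr_eq0 => /eqP ey.
  have d0 : 2 * y1 + a1 * x1 + a3 != 0.
    apply: contraNneq Hne => h; rewrite ey; apply/eqP; rewrite -[LHS]subr0 -h; ring.
  split; first by rewrite ey; ring.
  set l' := _ / _; have e1 : l' * (2 * y1 + a1 * x1 + a3)
      = 3 * x1 ^+ 2 + 2 * a2 * x1 + a4 - a1 * y1 by rewrite /l' divfK.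
  rewrite subrr mulr0 addr0 e1; ring.
apply/eqP; move: H1 k2; clear; move: l => l H1 k2.
set x3 := l ^+ 2 + a1 * l - a2 - x1 - x2.
move/eqP: H1; rewrite -subr_eq0 => /eqP H1.
move/eqP: k2; rewrite -subr_eq0 => /eqP k2.
apply/eqP; rewrite -subr_eq0; apply/eqP.
transitivity ((x3 - x1) * (l * (2 * y1 + l * (x2 - x1) + a1 * x2 + a3) + a1 * y1 -
     (x1 ^+ 2 + x1 * x2 + x2 ^+ 2 + a2 * (x1 + x2) + a4)) +
   (y1 ^+ 2 + a1 * x1 * y1 + a3 * y1 - (x1 ^+ 3 + a2 * x1 ^+ 2 + a4 * x1 + a6))).
  rewrite /x3; ring.
by rewrite k2 H1 mulr0 addr0.
Qed.

(* E(Q) *)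
Definition ec_point := {p : option (rat * rat) | on_curve p}.

Definition ec_zero : ec_point := exist _ None isT.
Definition ec_opp (p : ec_point) : ec_point :=
  exist _ (raw_opp (val p)) (raw_opp_on (valP p)).
Definition ec_add (p q : ec_point) : ec_point :=
  exist _ (raw_add (val p) (val q)) (raw_add_on (valP p) (valP q)).

Definition ec_muln (n : nat) (p : ec_point) : ec_point :=
  iter n (ec_add p) ec_zero.
Definition ec_mulz (n : int) (p : ec_point) : ec_point :=
  match n with
  | Posz m => ec_muln m p
  | Negz m => ec_opp (ec_muln m.+1 p)
  end.

(** * The Mordell-Weil lattice M_E = E(Q) / E(Q)_tors *)

Definition ec_torsion (p : ec_point) : Prop :=
  exists2 n : nat, (0 < n)%N & ec_muln n p = ec_zero.

(* Equality of the classes of [p] and [q] in M_E; elements of M_E are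
   represented by rational points throughout. *)
Definition mw_eq (p q : ec_point) : Prop := ec_torsion (ec_add p (ec_opp q)).

Definition ec_comb r (P : 'I_r -> ec_point) (n : 'rV[int]_r) : ec_point :=
  \big[ec_add/ec_zero]_(i < r) ec_mulz (n 0 i) (P i).

(* The classes of P_1, ..., P_r form a Z-basis of M_E; in particular E has
   Mordell-Weil rank r. *)
Definition mw_basis r (P : 'I_r -> ec_point) : Prop :=
  (forall n : 'rV[int]_r, mw_eq (ec_comb P n) ec_zero -> n = 0) /\
  (forall q : ec_point, exists n : 'rV[int]_r, mw_eq q (ec_comb P n)).

(* Coordinates of the class of [q] in the basis P (unique when P is a basis). *)
Definition mw_coord r (P : 'I_r -> ec_point) (q : ec_point) : 'rV[int]_r :=
  xget 0 [set n | mw_eq q (ec_comb P n)].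

Variable R : realType.

(* A basis P identifies V_E = M_E (x) R with R^r; this is the image of the
   class of [q] under M_E -> V_E. *)
Definition mw_vec r (P : 'I_r -> ec_point) (q : ec_point) : 'rV[R]_r :=
  map_mx intr (mw_coord P q).

(** * Canonical height, regulator, successive minima *)

(* Logarithmic Weil height on P^1(Q): [Some x] is [x : 1] and [None] is
   [1 : 0]. *)
Definition weil_height (x : option rat) : R :=
  if x is Some q then ln (Num.max `|numq q| (denq q))%:~R else 0.

Definition ec_x (p : ec_point) : option rat := omap fst (val p).

(* Not divided by 2: this is twice the height of Silverman's books. *)
Definition canonical_height (p : ec_point) : R :=
  limn (fun n : nat => weil_height (ec_x (ec_muln (2 ^ n) p)) / 4 ^+ n).

Definition height_pairing (p q : ec_point) : R :=
  (canonical_height (ec_add p q) - canonical_height p - canonical_height q) / 2.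

Definition regulator r (P : 'I_r -> ec_point) : R :=
  \det (\matrix_(i < r, j < r) height_pairing (P i) (P j)).

Definition mw_norm (p : ec_point) : R := Num.sqrt (canonical_height p).

(* The closed ball of radius l contains i vectors of M_E which are linearly
   independent in V_E. *)
Definition ball_has_indep r (P : 'I_r -> ec_point) (i : nat) (l : R) : Prop :=
  exists Q : 'I_i -> ec_point,
    (forall j, mw_norm (Q j) <= l) /\
    row_free (\matrix_(j < i) mw_vec P (Q j)).

Definition is_least (A : set R) (l : R) : Prop := A l /\ lbound A l.

(* The least element of the set, with junk value 0 if there were none. *)
Definition successive_minimum r (P : 'I_r -> ec_point) (i : nat) : R :=
  xget 0 [set l | is_least [set l' | ball_has_indep P i l'] l].

End Points.

(* Meaningful for 0 < s. *)
Definition Gamma (R : realType) (s : R) : R :=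
  \int[lebesgue_measure]_(t in `]0, +oo[) (t `^ (s - 1) * expR (- t)).

(* The volume of the unit ball of R^r. *)
Definition ball_volume (R : realType) (r : nat) : R :=
  pi `^ (r%:R / 2) / Gamma (r%:R / 2 + 1).

(* Main.v *)
From HB Require Import structures.
Require Import Defs.
From mathcomp Require Import all_boot all_order all_algebra.
From mathcomp Require Import ring lra zify.
From mathcomp Require Import all_classical all_reals all_analysis.
From mathcomp Require Import measurable_realfun.
Import Order.TTheory GRing.Theory Num.Theory.
Import numFieldNormedType.Exports.

Set Implicit Arguments.
Unset Strict Implicit.

Local Open Scope classical_set_scope.
Local Open Scope ring_scope.

(** The classes of the rational points in a basis P of E(Q) modulo torsion are
    identified with the integer vectors Z^r, and the canonical height becomes the
    quadratic form q(n) = n G n^T of the Gram matrix G of the height pairing.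
    The proof has an arithmetic half, which shows that q is a positive definite
    form with finitely many integer vectors below any bound, and a half in the
    geometry of numbers, which compares the determinant of G with the minima of q.

    Arithmetic. The chord-tangent operation is a group law ([ec_addA]): in
    coordinates where two of the points lie on the line y = 0, associativity is an
    identity between rational functions in free parameters, and the degenerate
    positions reduce to the generic one by cancellation.  Explicit polynomial
    formulas for the abscissae of P + Q and P - Q bound h(P + Q) + h(P - Q) above
    by 2 h(P) + 2 h(Q) + O(1) ([xheight_add_upper]), and Bezout identities with
    value the discriminant give h(2 P) >= 4 h(P) - O(1) ([xheight_dbl_lower]).
    Applying the first bound to P + Q and P - Q and then the second one gives the
    reverse inequality, so the limit that defines the canonical height exists and
    satisfies the parallelogram law exactly; hence it is a quadratic form that
    vanishes on torsion.  It differs boundedly from the Weil height, whence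
    finiteness ([northcott]).  A nonnegative form on Z^n with finitely many integer
    vectors below each bound is positive definite on R^n ([posdef_of_discrete]).

    Geometry of numbers. Let v_k be a shortest integer vector outside the real span
    of v_0, ..., v_(k-1); then sqrt (q v_k) is the successive minimum number k + 1
    ([successive_minimumE]).  Hadamard's inequality for the integral matrix with rows
    v_k gives det G <= prod q(v_k) ([det_le_prod]), which with
    2^r <= r! kappa_r is the left inequality.  For the right one, dividing the k-th
    Gram-Schmidt direction by the k-th minimum turns q into a form of determinant
    det G / prod q(v_k) that is at least 1 on nonzero integer vectors
    ([rescaled_form]), so that only Minkowski's first theorem for balls remains
    ([minkowski_ball]).

    The latter is proved with theta sums, without any volume in dimension r.
    Completing squares reduces the r-dimensional sum of exp (- e^2 q(n)) to
    one-dimensional Gaussian sums, so that e^r times the sum has lower limit at least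
    sqrt pi ^ r / sqrt (det q) as e tends to 0 ([theta_lower]).  On the other hand, if q >= 1
    on nonzero integer vectors, then vectors with q(n) < x^2 are distinct modulo any
    N >= 2 x, so there are at most (2 x + 1)^r of them; summation by layers bounds the
    same quantity by 2^r Gamma (r / 2 + 1) + O(e) ([theta_upper]).  Comparing the two
    gives kappa_r <= 2^r sqrt (det q). *)

(** * Quadratic forms over an ordered field *)

Section QuadraticForms.
Variable R : realFieldType.

Definition intv n (v : 'rV[int]_n) : 'rV[R]_n := map_mx intr v.

Definition bform n (M : 'M[R]_n) (u v : 'rV[R]_n) : R := (u *m M *m v^T) 0 0.
Definition qform n (M : 'M[R]_n) (v : 'rV[R]_n) : R := bform M v v.
Definition posdef n (M : 'M[R]_n) := M^T = M /\ forall v, v != 0 -> 0 < qform M v.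

Lemma bformC n (M : 'M[R]_n) u v : M^T = M -> bform M u v = bform M v u.
Proof.
move=> sM; rewrite /bform -[in RHS](trmxK (v *m M *m u^T)) [RHS]mxE.
by rewrite !trmx_mul trmxK sM mulmxA.
Qed.

Lemma bformDl n (M : 'M[R]_n) u1 u2 v : bform M (u1 + u2) v = bform M u1 v + bform M u2 v.
Proof. by rewrite /bform !mulmxDl mxE. Qed.

Lemma bformZl n (M : 'M[R]_n) c u v : bform M (c *: u) v = c * bform M u v.
Proof. by rewrite /bform -!scalemxAl mxE. Qed.

Lemma bformDr n (M : 'M[R]_n) u v1 v2 : bform M u (v1 + v2) = bform M u v1 + bform M u v2.
Proof. by rewrite /bform linearD mulmxDr mxE. Qed.

Lemma bformZr n (M : 'M[R]_n) c u v : bform M u (c *: v) = c * bform M u v.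
Proof. by rewrite /bform linearZ -scalemxAr mxE. Qed.

Lemma qformD n (M : 'M[R]_n) u v : M^T = M ->
  qform M (u + v) = qform M u + 2 * bform M u v + qform M v.
Proof. by move=> sM; rewrite /qform bformDl !bformDr (bformC v u sM); ring. Qed.

Lemma qformZ n (M : 'M[R]_n) c v : qform M (c *: v) = c ^+ 2 * qform M v.
Proof. by rewrite /qform bformZl bformZr expr2 mulrA. Qed.

Lemma qformN n (M : 'M[R]_n) v : qform M (- v) = qform M v.
Proof. by rewrite -scaleN1r qformZ sqrrN expr1n mul1r. Qed.

Lemma qform0 n (M : 'M[R]_n) : qform M 0 = 0.
Proof. by rewrite /qform /bform !mul0mx mxE. Qed.

Lemma qform_sub_le n (M : 'M[R]_n) u v : M^T = M -> (forall w, 0 <= qform M w) ->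
  qform M (u - v) <= 2 * (qform M u + qform M v).
Proof.
move=> sM p; have := p (u + v); have := qformD u v sM; have := qformD u (- v) sM.
by rewrite qformN -scaleN1r bformZr => *; lra.
Qed.

Lemma posdef_ge0 n (M : 'M[R]_n) v : posdef M -> 0 <= qform M v.
Proof. by move=> [_ p]; have [->|/p/ltW //] := eqVneq v 0; rewrite qform0. Qed.

Lemma qform_congr n m (M : 'M[R]_n) (A : 'M[R]_(m, n)) v :
  qform (A *m M *m A^T) v = qform M (v *m A).
Proof. by rewrite /qform /bform trmx_mul !mulmxA. Qed.

Lemma posdef_congr n (M A : 'M[R]_n) : posdef M -> A \in unitmx -> posdef (A *m M *m A^T).
Proof.
move=> [sM p] uA; split; first by rewrite !trmx_mul trmxK sM mulmxA.
move=> v v0; rewrite qform_congr; apply: p; apply: contraNneq v0 => e.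
by rewrite -[v](mulmxK uA) e mul0mx.
Qed.

Lemma qform_diag n (e : 'rV[R]_n) v : qform (diag_mx e) v = \sum_i v 0 i ^+ 2 * e 0 i.
Proof.
rewrite /qform /bform mxE; apply: eq_bigr => i _.
by rewrite mul_mx_diag !mxE; ring.
Qed.

Lemma posdef_diag n (e : 'rV[R]_n) : (forall i, 0 < e 0 i) -> posdef (diag_mx e).
Proof.
move=> e0; split=> [|v v0]; first by rewrite tr_diag_mx.
have [i vi] : exists i, v 0 i != 0.
  apply/existsP; apply: contraNT v0; rewrite negb_exists => /forallP h.
  by apply/eqP/rowP => i; rewrite mxE; apply/eqP; have := h i; rewrite negbK.
rewrite qform_diag (bigD1 i) //=; apply: ltr_pwDl; first by rewrite mulr_gt0 // exprn_even_gt0.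
by apply: sumr_ge0 => j _; rewrite mulr_ge0 ?sqr_ge0 // ltW.
Qed.

(** Completing the square in the first variable splits a form of n + 1 variables
    into a one-variable form and the Schur complement; this is the inductive step
    of every argument below that works one variable at a time. *)
Section Schur.
Variables (n : nat) (M : 'M[R]_(1 + n)).
Hypothesis pM : posdef M.

Definition pivot : R := M 0 0.
Definition offdiag : 'rV[R]_n := ursubmx M.
Definition schur : 'M[R]_n := drsubmx M - pivot^-1 *: (offdiag^T *m offdiag).

Lemma schur_block : M = block_mx pivot%:M offdiag offdiag^T (drsubmx M).
Proof.
have [sM _] := pM; rewrite /offdiag trmx_ursub sM.
rewrite -[LHS]submxK; congr block_mx.
by rewrite [LHS]mx11_scalar; congr _%:M; rewrite !mxE; congr (M _ _); apply: val_inj.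
Qed.

Lemma pivot_gt0 : 0 < pivot.
Proof.
have [_ p] := pM; have := p (row_mx 1%:M 0).
rewrite row_mx_eq0 negb_and -[1%:M == 0]/(1%:M == 0 :> 'M[R]_1) oner_eq0 /= => /(_ isT).
rewrite /qform /bform {1}schur_block mul_row_block tr_row_mx mul_row_col.
by rewrite !(mul0mx, mulmx0, trmx0, addr0, mul1mx, trmx1, mulmx1) mxE eqxx mulr1n.
Qed.

Lemma qform_schur (x : R) (y : 'rV[R]_n) :
  qform M (row_mx x%:M y) =
  pivot * (x + (y *m offdiag^T) 0 0 / pivot) ^+ 2 + qform schur y.
Proof.
have a0 := gt_eqF pivot_gt0.
rewrite /qform /bform {1}schur_block mul_row_block tr_row_mx mul_row_col /schur.
set b := offdiag; set C := drsubmx M; set s := (y *m b^T) 0 0.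
have sE : y *m b^T = s%:M by rewrite [LHS]mx11_scalar.
have sE' : b *m y^T = s%:M by rewrite -[LHS]trmxK trmx_mul trmxK sE tr_scalar_mx.
have e1 : (y *m (C - pivot^-1 *: (b^T *m b)) *m y^T) 0 0 =
    (y *m C *m y^T) 0 0 - s ^+ 2 / pivot.
  have e : y *m (b^T *m b) *m y^T = s%:M *m s%:M by rewrite -{1}sE -sE' !mulmxA.
  rewrite mulmxBr mulmxBl -scalemxAr -scalemxAl e.
  by rewrite -scalar_mxM !mxE eqxx mulr1n; ring.
rewrite e1 tr_scalar_mx !mulmxDl -[x%:M *m b *m _]mulmxA sE sE' -!scalar_mxM.
move: (y *m C *m y^T) => Q; rewrite ![in LHS]mxE eqxx !mulr1n.
by field; rewrite a0.
Qed.

Lemma schur_posdef : posdef schur.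
Proof.
have [sM p] := pM; split.
  rewrite /schur linearB linearZ /= trmx_mul trmxK; congr (_ - _).
  by rewrite trmx_drsub sM.
move=> y y0; have := p (row_mx (- ((y *m offdiag^T) 0 0 / pivot))%:M y).
rewrite qform_schur addNr expr0n mulr0 add0r; apply.
by rewrite row_mx_eq0 negb_and y0 orbT.
Qed.

Lemma det_schur : \det M = pivot * \det schur.
Proof.
have a0 := gt_eqF pivot_gt0.
pose U : 'M[R]_(1 + n) := block_mx 1%:M 0 (- pivot^-1 *: offdiag^T) 1%:M.
have dU : \det U = 1 by rewrite det_lblock !det1 mulr1.
rewrite -[LHS]mul1r -dU -det_mulmx [X in _ *m X]schur_block mulmx_block.
rewrite !mul1mx !mul0mx !addr0 -scalemxAl mul_mx_scalar scalerA mulNr mulVf ?a0 //.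
rewrite scaleN1r addNr det_ublock det_scalar1; congr (_ * \det _).
by rewrite -scalemxAl scaleNr addrC.
Qed.
End Schur.

Lemma posdef_det_gt0 n (M : 'M[R]_n) : posdef M -> 0 < \det M.
Proof.
elim: n M => [|n IH] M pM; first by rewrite det_mx00.
by rewrite (det_schur pM) mulr_gt0 ?IH ?(pivot_gt0 pM) //; exact: schur_posdef.
Qed.

(** When M is the Gram matrix of independent vectors, the rows of L express them in
    their Gram-Schmidt orthogonalisation and d holds the squared lengths of the
    latter.  One step of elimination leaves the Schur complement, to which
    induction applies. *)
Lemma gram_schmidt n (M : 'M[R]_n) : posdef M ->
  exists (L : 'M[R]_n) (d : 'rV[R]_n),
    [/\ is_trig_mx L, forall i, L i i = 1, forall i, 0 < d 0 i & M = L *m diag_mx d *m L^T].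
Proof.
elim: n M => [|n IH] M pM.
  by exists 0, 0; split; rewrite ?[M]flatmx0 ?mulmx0 ?flatmx0 //; [apply/is_trig_mxP|..] => -[].
have [L [d [tL L1 d0 SE]]] := IH _ (schur_posdef pM).
pose b := offdiag M; pose a := pivot M.
have a0 : a != 0 by rewrite gt_eqF // (pivot_gt0 pM).
pose L' : 'M[R]_(1 + n) := block_mx 1%:M 0 (a^-1 *: b^T) L.
pose d' : 'rV[R]_(1 + n) := row_mx a%:M d.
have ME : L' *m diag_mx d' *m L'^T = M.
  have -> : diag_mx d' = block_mx a%:M 0 0 (diag_mx d).
    rewrite /d' diag_mx_row; congr block_mx; apply/matrixP => i j.
    by rewrite !mxE !ord1.
  rewrite [RHS](schur_block pM) /L' tr_block_mx !mulmx_block.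
  rewrite !(mul0mx, mulmx0, mul1mx, addr0, add0r, trmx0, trmx1, mulmx1).
  have e1 : (a^-1 *: b^T) *m a%:M = b^T by rewrite mul_mx_scalar scalerA mulfV // scale1r.
  have e2 : a%:M *m (a^-1 *: b^T)^T = b.
    by rewrite linearZ /= trmxK mul_scalar_mx scalerA mulfV // scale1r.
  rewrite e1 e2 linearZ /= trmxK -SE /schur -scalemxAr -/b -/a; congr block_mx.
  by rewrite addrC subrK.
exists L', d'; split=> //.
- apply/is_trig_mxP => i j.
  case: (@split_ordP 1 n i) => i' ->; case: (@split_ordP 1 n j) => j' ->.
  + by rewrite !ord1 ltnn.
  + by move=> _; rewrite [LHS]block_mxEur mxE.
  + by rewrite [j']ord1.
  + by rewrite /= !add1n ltnS => h; rewrite [LHS]block_mxEdr; apply: (is_trig_mxP tL).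
- move=> i; case: (@split_ordP 1 n i) => i' ->.
    by rewrite [LHS]block_mxEul !mxE ord1 eqxx.
  by rewrite [LHS]block_mxEdr.
- move=> i; case: (@split_ordP 1 n i) => i' ->.
    by rewrite [ltRHS]row_mxEl !mxE !ord1 eqxx mulr1n (pivot_gt0 pM).
  by rewrite [ltRHS]row_mxEr.
Qed.

End QuadraticForms.

(** * The group law on E(Q) *)

(** The equation satisfied by (X, Y) when x = X + u and y = Y + s X + t.  Such a change
    of coordinates maps lines to lines and fixes the point at infinity, so it
    commutes with the chord-tangent operation; it is used to bring a chosen chord
    to the line Y = 0. *)
Definition translate_model (W : weierstrass) (u s t : rat) : weierstrass :=
  Weierstrass (wa1 W + 2 * s)
    (wa2 W + 3 * u - s ^+ 2 - wa1 W * s)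
    (wa3 W + 2 * t + wa1 W * u)
    (wa4 W + 2 * wa2 W * u + 3 * u ^+ 2 - 2 * s * t - wa1 W * (t + u * s) - wa3 W * s)
    (wa6 W + wa4 W * u + wa2 W * u ^+ 2 + u ^+ 3 - t ^+ 2 - wa1 W * u * t - wa3 W * t).

Lemma translate_disc W u s t : wdisc (translate_model W u s t) = wdisc W.
Proof. by rewrite /wdisc /wb2 /wb4 /wb6 /wb8 /=; ring. Qed.

Lemma translate_smooth (E : elliptic_curve) u s t :
  wdisc (translate_model E u s t) != 0.
Proof. by rewrite translate_disc ec_smooth. Qed.

Definition translate (E : elliptic_curve) u s t : elliptic_curve :=
  EllipticCurve (translate_smooth E u s t).

Definition translate_pt (u s t : rat) (p : option (rat * rat)) :=
  if p is Some (x, y) then Some (x - u, y - s * (x - u) - t) else None.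

Lemma translate_pt_inj u s t : injective (translate_pt u s t).
Proof.
move=> [[x y]|] [[x' y']|] //= [/addIr <- /addIr e]; congr (Some (_, _)).
exact: (addIr _ e).
Qed.

(** The ordinates above x are the two roots of a quadratic, exchanged by negation. *)
Lemma same_abscissa (E : elliptic_curve) x y1 y2 :
    on_curve E (Some (x, y1)) -> on_curve E (Some (x, y2)) ->
  y2 = y1 \/ y2 = - y1 - wa1 E * x - wa3 E.
Proof.
move=> /= /eqP H1 /eqP H2.
have : (y2 - y1) * (y2 - (- y1 - wa1 E * x - wa3 E)) = 0.
  by rewrite -[RHS](subrr (x ^+ 3 + wa2 E * x ^+ 2 + wa4 E * x + wa6 E)) -{1}H2 -H1; ring.
by move/eqP; rewrite mulf_eq0 !subr_eq0 => /orP [/eqP|/eqP]; [left|right].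
Qed.

(** Two points with the same abscissa that are not opposite are equal and have a
    tangent that is not vertical, so the slope formula does not divide by zero. *)
Lemma tangent_case (E : elliptic_curve) x y1 y2 :
    on_curve E (Some (x, y1)) -> on_curve E (Some (x, y2)) ->
    y2 != - y1 - wa1 E * x - wa3 E ->
  y2 = y1 /\ 2 * y1 + wa1 E * x + wa3 E != 0.
Proof.
move=> o1 o2 ne; case: (same_abscissa o1 o2) => [e|/eqP]; last by rewrite (negbTE ne).
split=> //; apply: contraNneq ne => h.
by rewrite e; apply/eqP; rewrite -[LHS]subr0 -h; ring.
Qed.

Section Translate.
Variables (E : elliptic_curve) (u s t : rat).
Local Notation E' := (translate E u s t).
Local Notation T := (translate_pt u s t).

Lemma translate_on p : on_curve E' (T p) = on_curve E p.
Proof.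
case: p => [[x y]|] //=; rewrite -[LHS]subr_eq0 -[RHS]subr_eq0; congr (_ == 0).
ring.
Qed.

Lemma translate_opp p : T (raw_opp E p) = raw_opp E' (T p).
Proof. by case: p => [[x y]|] //=; congr (Some (_, _)); ring. Qed.

Lemma translate_slope x1 y1 x2 y2 :
    on_curve E (Some (x1, y1)) -> on_curve E (Some (x2, y2)) ->
    ~~ ((x1 == x2) && (y2 == - y1 - wa1 E * x1 - wa3 E)) ->
  ec_slope E' (x1 - u) (y1 - s * (x1 - u) - t) (x2 - u) (y2 - s * (x2 - u) - t) =
  ec_slope E x1 y1 x2 y2 - s.
Proof.
move=> o1 o2; rewrite /ec_slope (inj_eq (addIr _)).
case: (eqVneq x1 x2) => [e|ne] /= h; last first.
  by field; rewrite subr_eq0 eq_sym.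
subst x2; have [_ d] := tangent_case o1 o2 h.
have -> : 2 * (y1 - s * (x1 - u) - t) + (wa1 E + 2 * s) * (x1 - u) +
    (wa3 E + 2 * t + wa1 E * u) = 2 * y1 + wa1 E * x1 + wa3 E by ring.
by field.
Qed.

Lemma translate_add p q : on_curve E p -> on_curve E q ->
  T (raw_add E p q) = raw_add E' (T p) (T q).
Proof.
case: p q => [[x1 y1]|] [[x2 y2]|] // o1 o2.
rewrite [RHS]/= (inj_eq (addIr _)).
have -> : (y2 - s * (x2 - u) - t ==
   - (y1 - s * (x1 - u) - t) - (wa1 E + 2 * s) * (x1 - u) -
   (wa3 E + 2 * t + wa1 E * u)) =
   (y2 - s * (x2 - x1) == - y1 - wa1 E * x1 - wa3 E).
  by rewrite -[LHS]subr_eq0 -[RHS]subr_eq0; congr (_ == 0); ring.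
rewrite /=; case: (eqVneq x1 x2) => [e|ne] /=.
  have -> : x2 - x1 = 0 by rewrite e subrr.
  rewrite mulr0 subr0; case: ifPn => h //.
  rewrite translate_slope //; last by rewrite e eqxx -e.
  by set l := ec_slope _ _ _ _ _; congr (Some (_, _)); ring.
rewrite translate_slope //; last by rewrite (negbTE ne).
by set l := ec_slope _ _ _ _ _; congr (Some (_, _)); ring.
Qed.

End Translate.

Lemma raw_oppK E : involutive (raw_opp E).
Proof. by move=> [[x y]|] //=; congr (Some (_, _)); ring. Qed.

Lemma raw_addNp E p : raw_add E p (raw_opp E p) = None.
Proof. by case: p => [[x y]|] //=; rewrite !eqxx. Qed.

Lemma raw_add0 E p : raw_add E p None = p.
Proof. by case: p => [[x y]|]. Qed.

Lemma raw_addC (E : elliptic_curve) p q : on_curve E p -> on_curve E q ->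
  raw_add E p q = raw_add E q p.
Proof.
case: p q => [[x1 y1]|] [[x2 y2]|] // o1 o2 /=.
rewrite [x2 == x1]eq_sym; case: (eqVneq x1 x2) => [e|ne] /=.
  rewrite -e.
  have -> : (y1 == - y2 - wa1 E * x1 - wa3 E) = (y2 == - y1 - wa1 E * x1 - wa3 E).
    by rewrite -subr_eq0 -[RHS]subr_eq0; congr (_ == 0); ring.
  case: ifPn => // h; rewrite -e in o2.
  by have [-> _] := tangent_case o1 o2 h.
rewrite /ec_slope [x2 == x1]eq_sym (negbTE ne).
have d : x2 - x1 != 0 by rewrite subr_eq0 eq_sym.
have d' : x1 - x2 != 0 by rewrite subr_eq0.
by congr (Some (_, _)); field; rewrite d d'.
Qed.

Lemma raw_addN (E : elliptic_curve) p q : on_curve E p -> on_curve E q ->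
  raw_opp E (raw_add E p q) = raw_add E (raw_opp E p) (raw_opp E q).
Proof.
case: p q => [[x1 y1]|] [[x2 y2]|] // o1 o2 /=.
case: (eqVneq x1 x2) => [e|ne] /=.
  rewrite -e.
  have -> : (- y2 - wa1 E * x1 - wa3 E == - (- y1 - wa1 E * x1 - wa3 E) - wa1 E * x1 - wa3 E)
    = (y2 == - y1 - wa1 E * x1 - wa3 E).
    by rewrite -subr_eq0 -[RHS]subr_eq0 -oppr_eq0; congr (_ == 0); ring.
  case: ifPn => // h; rewrite -e in o2.
  have [-> d] := tangent_case o1 o2 h; rewrite /ec_slope eqxx /=.
  have -> : 2 * (- y1 - wa1 E * x1 - wa3 E) + wa1 E * x1 + wa3 E =
    - (2 * y1 + wa1 E * x1 + wa3 E) by ring.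
  by congr (Some (_, _)); field; rewrite ?oppr_eq0 d.
rewrite /ec_slope (negbTE ne).
have d : x2 - x1 != 0 by rewrite subr_eq0 eq_sym.
by congr (Some (_, _)); field.
Qed.

(** The line y = 0 meets the curve in the abscissae 0, al and be, counted with
    multiplicity. *)
Definition normal_form (E : elliptic_curve) (al be : rat) :=
  [/\ wa6 E = 0, wa4 E = al * be & wa2 E = - (al + be)].

Lemma normal_form_sym E al be : normal_form E al be -> normal_form E be al.
Proof. by case=> h6 h4 h2; split; rewrite ?h4 ?h2 // 1?mulrC // addrC. Qed.

Lemma to_normal_form (E : elliptic_curve) p q :
    on_curve E p -> on_curve E q -> p != None -> q != None ->
    q != raw_opp E p ->
  exists u s t al be,
    [/\ translate_pt u s t p = Some (0, 0), translate_pt u s t q = Some (al, 0)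
      & normal_form (translate E u s t) al be].
Proof.
case: p q => [[x1 y1]|] [[x2 y2]|] // o1 o2 _ _ ne.
pose l := ec_slope E x1 y1 x2 y2.
exists x1, l, y1, (x2 - x1), (- wa2 (translate E x1 l y1) - (x2 - x1)).
have h6 : wa6 (translate E x1 l y1) = 0.
  have /= := o1; rewrite -subr_eq0 => /eqP z.
  by apply: oppr_inj; rewrite oppr0 -[RHS]z /=; ring.
have k : y2 - y1 = l * (x2 - x1).
  rewrite /l /ec_slope; case: (eqVneq x1 x2) => [e|n].
    have /= : y2 != - y1 - wa1 E * x1 - wa3 E by apply: contraNneq ne => ->; rewrite /= e.
    by rewrite -e in o2 * => /(tangent_case o1 o2) [-> _]; rewrite !subrr mulr0.
  by rewrite divfK // subr_eq0 eq_sym.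
split; first by congr (Some (_, _)); ring.
  by rewrite /= -k; congr (Some (_, _)); ring.
split; [exact: h6 | | by ring].
case: (eqVneq x1 x2) => [e|n].
  have /= h : y2 != - y1 - wa1 E * x1 - wa3 E by apply: contraNneq ne => ->; rewrite /= e.
  rewrite -e in o2.
  have [_ d] := tangent_case o1 o2 h.
  rewrite e subrr mul0r -e /=.
  have e2 : l * (2 * y1 + wa1 E * x1 + wa3 E) = 3 * x1 ^+ 2 + 2 * wa2 E * x1 + wa4 E - wa1 E * y1.
    by rewrite /l /ec_slope e eqxx divfK // -e.
  by rewrite -[RHS](subrr (l * (2 * y1 + wa1 E * x1 + wa3 E))) {1}e2; ring.
have d : x2 - x1 != 0 by rewrite subr_eq0 eq_sym.
have o' : on_curve (translate E x1 l y1) (Some (x2 - x1, 0)).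
  have <- : translate_pt x1 l y1 (Some (x2, y2)) = Some (x2 - x1, 0).
    by rewrite /= -k; congr (Some (_, _)); ring.
  by rewrite translate_on.
move: o' h6 => /eqP; move: (translate E x1 l y1) => E'.
move: (wa1 E') (wa2 E') (wa3 E') (wa4 E') (wa6 E').
move=> b1 b2 b3 b4 b6 z h6; rewrite h6 in z.
apply: (mulfI d); apply/eqP; rewrite -subr_eq0; apply/eqP.
move/eqP: z; rewrite eq_sym -subr_eq0 => /eqP z.
by rewrite -[RHS]z; ring.
Qed.

(** Otherwise (0, 0) would be a singular point.  This is where the discriminant
    enters the group law. *)
Lemma normal_form_a3 (E : elliptic_curve) be : normal_form E 0 be -> wa3 E != 0.
Proof.
case=> h6 h4 h2; apply: contraNneq (ec_smooth E) => h3.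
by rewrite /wdisc /wb2 /wb4 /wb6 /wb8 h6 h4 h3 mul0r; apply/eqP; ring.
Qed.

(** The chord, or the tangent when al = 0, is the line y = 0, whose third point is
    (be, 0). *)
Lemma add_normal_form (E : elliptic_curve) al be : normal_form E al be ->
  raw_add E (Some (0, 0)) (Some (al, 0)) = Some (be, - wa1 E * be - wa3 E).
Proof.
move=> nf /=; have h : ~~ ((0 == al) && (0 == - 0 - wa1 E * 0 - wa3 E)).
  case: eqP => //= e; rewrite -e in nf.
  apply: contraNneq (normal_form_a3 nf) => z; apply/eqP/oppr_inj.
  by rewrite oppr0 z; ring.
rewrite (negbTE h).
have -> : ec_slope E 0 0 al 0 = 0.
  rewrite /ec_slope; case: eqP => [e|_]; last by rewrite subrr mul0r.
  by case: nf => _ -> _; rewrite -e; apply/eqP; rewrite mulf_eq0; apply/orP; left; apply/eqP; ring.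
by case: nf => _ _ ->; congr (Some (_, _)); ring.
Qed.

(** In normal form p, q and -(p + q) are the three points of the line y = 0, and the sum
    of any two of them is the opposite of the third. *)
Lemma raw_addK (E : elliptic_curve) p q : on_curve E p -> on_curve E q ->
  raw_add E (raw_add E p q) (raw_opp E q) = p.
Proof.
move=> op oq.
have [->|p0] := eqVneq p None; first by case: (q) => [z|] //; exact: raw_addNp.
have [->|q0] := eqVneq q None; first by rewrite !raw_add0.
have [e|ne] := eqVneq p (raw_opp E q).
  by rewrite e [raw_add E (raw_opp E q) q]raw_addC ?raw_addNp ?raw_opp_on.
have [u [s [t [al [be [hq hp nf]]]]]] := to_normal_form oq op q0 p0 ne.
have oN r : on_curve E r -> on_curve E (raw_opp E r) by exact: raw_opp_on.
have oA r r' : on_curve E r -> on_curve E r' -> on_curve E (raw_add E r r') by exact: raw_add_on.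
apply: (@translate_pt_inj u s t); rewrite translate_add ?oA ?oN //.
rewrite translate_add // translate_opp hp hq.
set E' := translate E u s t in nf *.
have o0 : on_curve E' (Some (0, 0)) by rewrite -hq translate_on.
have oal : on_curve E' (Some (al, 0)) by rewrite -hp translate_on.
rewrite [raw_add E' (Some (al, 0)) _]raw_addC // (add_normal_form nf).
have -> : Some (be, - wa1 E' * be - wa3 E') = raw_opp E' (Some (be, 0)).
  by rewrite /=; congr (Some (_, _)); ring.
have obe : on_curve E' (Some (be, 0)).
  case: nf => h6 h4 h2; apply/eqP; rewrite h6 h4 h2; ring.
rewrite -raw_addN // raw_addC // (add_normal_form (normal_form_sym nf)).
by rewrite /=; congr (Some (_, _)); ring.
Qed.

Lemma abscissa_neq (E : elliptic_curve) x1 y1 x2 y2 :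
    on_curve E (Some (x1, y1)) -> on_curve E (Some (x2, y2)) ->
    Some (x1, y1) != Some (x2, y2) -> Some (x2, y2) != raw_opp E (Some (x1, y1)) ->
  x1 != x2.
Proof.
move=> o1 o2 n1 n2; apply/eqP => e; rewrite -e in o2 n1 n2.
case: (same_abscissa o1 o2) => h; first by rewrite h eqxx in n1.
by rewrite h /= eqxx in n2.
Qed.

(** With q and r on the line y = 0, the curve has the four parameters al, be, a1, a3,
    and since y1 is not 0 the equation of the curve at (x1, y1) can be solved for a3.
    Then x1, y1, al, be, a1 are free and associativity is an identity of rational
    functions.  The case al = 0 covers q = r. *)
Lemma generic_assoc_normal (E : elliptic_curve) x1 y1 al be :
    normal_form E al be -> on_curve E (Some (x1, y1)) ->
    x1 != 0 -> y1 != 0 -> x1 != be ->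
    let pq := raw_add E (Some (x1, y1)) (Some (0, 0)) in
    omap fst pq != Some al ->
  raw_add E pq (Some (al, 0)) =
  raw_add E (Some (x1, y1)) (Some (be, - wa1 E * be - wa3 E)).
Proof.
case=> h6 h4 h2 /eqP o1 x10 y10 x1be /=.
rewrite (negbTE x10) (negbTE x1be) /= [ec_slope _ x1 y1 0 0]/ec_slope (negbTE x10).
rewrite [ec_slope _ x1 y1 be _]/ec_slope (negbTE x1be).
set x4 := _ - 0; rewrite [Some _ != _](_ : _ = (x4 != al)) // => x4al.
rewrite (negbTE x4al) /ec_slope (negbTE x4al).
move: o1 x4al; rewrite /x4 h6 h4 h2 {x4 h6 h4 h2}.
move: (wa1 E) (wa3 E) => a1 a3 o1.
(* a3 is eliminated: it enters the equation linearly with coefficient y1 *)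
have {o1} -> : a3 = (x1 * (x1 - al) * (x1 - be) - y1 ^+2 - a1 * x1 * y1) / y1.
  apply: (mulIf y10); rewrite divfK //.
  apply/eqP; rewrite -subr_eq0; apply/eqP.
  by move/eqP: o1; rewrite -subr_eq0 => /eqP <-; ring.
rewrite -subr_eq0 => x4al.
have d : be - x1 != 0 by rewrite subr_eq0 eq_sym.
have {x4al} hD : al * (- x1 * - x1) -
    ((- y1) ^+ 2 + a1 * - y1 * - x1 + - - (al + be) * (- x1 * - x1) +
     - x1 * (- x1 * - x1)) != 0.
  apply: contraNneq x4al => z.
  rewrite [X in X == 0](_ : _ = (al * (- x1 * - x1) -
    ((- y1) ^+ 2 + a1 * - y1 * - x1 + - - (al + be) * (- x1 * - x1) +
     - x1 * (- x1 * - x1))) * - (x1 * x1)^-1); first by rewrite z mul0r.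
  by field.
by congr (Some (_, _)); field; rewrite d y10 x10 hD.
Qed.

Section Associativity.
Variable E : elliptic_curve.
Local Notation "p +' q" := (ec_add p q) (at level 50, left associativity).
Local Notation "-' p" := (ec_opp p) (at level 35).
Local Notation O := (ec_zero E).
Implicit Types p q r : ec_point E.

Lemma ec_addC p q : p +' q = q +' p.
Proof. by apply: val_inj; apply: raw_addC; apply: valP. Qed.
Lemma ec_add0p p : O +' p = p.
Proof. exact: val_inj. Qed.
Lemma ec_addp0 p : p +' O = p.
Proof. by rewrite ec_addC ec_add0p. Qed.
Lemma ec_addpN p : p +' -' p = O.
Proof. by apply: val_inj; exact: raw_addNp. Qed.
Lemma ec_addNp p : -' p +' p = O.
Proof. by rewrite ec_addC ec_addpN. Qed.
Lemma ec_oppK : involutive (fun p => -' p).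
Proof. by move=> p; apply: val_inj; exact: raw_oppK. Qed.
Lemma ec_oppD p q : -' (p +' q) = -' p +' -' q.
Proof. by apply: val_inj; apply: raw_addN; apply: valP. Qed.
Lemma ec_addK p q : p +' q +' -' q = p.
Proof. by apply: val_inj; apply: raw_addK; apply: valP. Qed.
Lemma ec_addNK p q : p +' -' q +' q = p.
Proof. by rewrite -{2}[q]ec_oppK ec_addK. Qed.
Lemma ec_addKl p q : -' p +' (p +' q) = q.
Proof. by rewrite ec_addC [p +' q]ec_addC ec_addK. Qed.
Lemma ec_addNKl p q : p +' (-' p +' q) = q.
Proof. by rewrite -{1}[p]ec_oppK ec_addKl. Qed.
Lemma ec_addI p : injective (fun q => p +' q).
Proof. by move=> q r e; rewrite -(ec_addKl p q) e ec_addKl. Qed.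
Lemma ec_addIr p : injective (fun q => q +' p).
Proof. by move=> q r e; rewrite -(ec_addK q p) e ec_addK. Qed.
(** The hypotheses exclude p = r, where the claim is commutativity, and the positions in
    which an addition other than q + r would be a doubling; additions of opposite
    points are dealt with by cancellation. *)
Lemma generic_assoc p q r : p <> q -> p <> r -> p +' q <> r -> p <> q +' r ->
  p +' q +' r = p +' (q +' r).
Proof.
move=> pq pr pqr pqr'.
have [->|q0] := eqVneq q O; first by rewrite ec_addp0 ec_add0p.
have [->|p0] := eqVneq p O; first by rewrite !ec_add0p.
have [->|r0] := eqVneq r O; first by rewrite !ec_addp0.
have [->|npq] := eqVneq p (-' q); first by rewrite ec_addNp ec_add0p ec_addKl.
have [->|nqr] := eqVneq r (-' q).
  by rewrite ec_addpN ec_addp0 ec_addK.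
have [->|npqr] := eqVneq r (-' (p +' q)).
  by rewrite ec_addpN ec_oppD [q +' _]ec_addC ec_addNK ec_addpN.
have [->|npqr'] := eqVneq p (-' (q +' r)).
  by rewrite ec_addNp ec_oppD [-' q +' _]ec_addC ec_addNK ec_addNp.
have [u [s [t [al [be [hq hr nf]]]]]] :
  exists u s t al be,
    [/\ translate_pt u s t (val q) = Some (0, 0), translate_pt u s t (val r) = Some (al, 0)
      & normal_form (translate E u s t) al be].
  apply: to_normal_form; rewrite ?(valP q) ?(valP r) //.
apply: val_inj; apply: (@translate_pt_inj u s t) => /=.
have ov x : on_curve E (val x) := valP x.
have oN x : on_curve E x -> on_curve E (raw_opp E x) by exact: raw_opp_on.
have oA x x' : on_curve E x -> on_curve E x' -> on_curve E (raw_add E x x') by exact: raw_add_on.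
rewrite !translate_add ?oA ?ov // hq hr.
set E' := translate E u s t in nf *.
rewrite (add_normal_form nf).
have hqr : translate_pt u s t (val (q +' r)) = Some (be, - wa1 E' * be - wa3 E').
  by rewrite translate_add ?ov // hq hr (add_normal_form nf).
have diff (a b : ec_point E) xa ya xb yb :
    translate_pt u s t (val a) = Some (xa, ya) ->
    translate_pt u s t (val b) = Some (xb, yb) -> a <> b -> a != -' b -> xa != xb.
  move=> ha hb ab nab.
  have oa : on_curve E' (Some (xa, ya)) by rewrite -ha translate_on ov.
  have ob : on_curve E' (Some (xb, yb)) by rewrite -hb translate_on ov.
  apply: (abscissa_neq oa ob).
    by apply/eqP; rewrite -ha -hb => /translate_pt_inj /val_inj.
  apply: contraNneq nab; rewrite -ha -hb -translate_opp => /translate_pt_inj.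
  by move=> e; apply/eqP/val_inj; rewrite /= e raw_oppK.
case ep : (translate_pt u s t (val p)) => [[x1 y1]|]; last first.
  by case/eqP: p0; apply: val_inj; case: (val p) ep => [[]|].
have x10 : x1 != 0 by exact: diff ep hq pq npq.
have x1be : x1 != be by exact: diff ep hqr pqr' npqr'.
have o1 : on_curve E' (Some (x1, y1)) by rewrite -ep translate_on ov.
have x1al : p <> r -> y1 = 0 -> x1 != al.
  move=> _ y10; apply/eqP => e; apply: pr; apply: val_inj.
  by apply: (@translate_pt_inj u s t); rewrite ep hr y10 e.
apply: generic_assoc_normal => //.
  apply: contraPneq (pr) => y10; move: (x1al pr y10) o1 => {}x1al.
  case: nf => h6 h4 h2; rewrite y10 /on_curve h6 h4 h2 => /eqP z.
  have : x1 * (x1 - al) * (x1 - be) = 0.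
    apply/eqP; move/eqP: z; rewrite eq_sym -subr_eq0 => /eqP z.
    by apply/eqP; rewrite -[RHS]z; ring.
  by move/eqP; rewrite !mulf_eq0 !subr_eq0 (negbTE x10) (negbTE x1al) (negbTE x1be).
rewrite -ep -hq -translate_add ?ov // -/(val (p +' q)).
case epq : (translate_pt u s t _) => [[x4 y4]|] //=.
apply/eqP => -[e]; have := diff (p +' q) r _ _ _ _ epq hr pqr.
rewrite e eqxx => h; suff: false by []. apply: h.
by apply: contraNneq npqr => ->; rewrite ec_oppK.
Qed.

(** By commutativity this is the generic case for the triple r, s, s. *)
Lemma ec_add_dbl s r : r <> s +' s -> s +' s +' r = s +' (s +' r).
Proof.
move=> rs; have [->|/eqP sr] := eqVneq s r; first by rewrite ec_addC.
have [->|/eqP r0] := eqVneq r O; first by rewrite !ec_addp0.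
rewrite ec_addC [in RHS]ec_addC [s +' r]ec_addC.
have rs' : r <> s by move=> e; apply: sr.
rewrite generic_assoc // => e.
by apply: r0; apply: (@ec_addIr s); rewrite /= e ec_add0p.
Qed.

(** With s = p + q, cancelling -p turns the claim into (s + s) - p = s + (s - p), an
    instance of [ec_add_dbl] unless -p = s + s.  In the exceptional case p and q are
    multiples of s and the same trick is applied to 2 s and -s. *)
Lemma ec_add_sum p q : p +' q +' (p +' q) = p +' (q +' (p +' q)).
Proof.
set s := p +' q.
have sp : s +' -' p = q by rewrite /s ec_addC ec_addKl.
have [e|/eqP ne] := eqVneq (-' p) (s +' s); last first.
  have := ec_add_dbl ne; rewrite sp => h.
  by rewrite [q +' s]ec_addC -h ec_addC ec_addNK.
have pE : p = -' (s +' s) by rewrite -e ec_oppK.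
have qE : q = s +' (s +' s) by rewrite -sp e.
rewrite pE; apply: (@ec_addI (s +' s)) => /=; rewrite ec_addNKl.
rewrite qE [s +' (s +' s) +' s]ec_addC.
apply: (@ec_addIr (-' s)) => /=.
rewrite [X in _ = X +' _]ec_addC [RHS]ec_addK.
have [f|/eqP nf] := eqVneq (-' s) (s +' s +' (s +' s)); last first.
  by rewrite (ec_add_dbl nf) ec_addK ec_addC.
have g : s +' s = -' (s +' (s +' s)) by rewrite ec_oppD f ec_addK.
by rewrite -f -ec_oppD [X in -' X]g ec_oppK.
Qed.

Lemma ec_addA p q r : p +' (q +' r) = p +' q +' r.
Proof.
have [->|/eqP pr] := eqVneq p r.
  by rewrite ec_addC; congr (_ +' _); rewrite ec_addC.
have [->|/eqP rpq] := eqVneq r (p +' q); first by rewrite ec_add_sum.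
have [->|/eqP pqr] := eqVneq p (q +' r).
  by rewrite [RHS]ec_addC [q +' r +' q]ec_addC [q +' r]ec_addC ec_add_sum.
have [e|/eqP pq] := eqVneq p q; last first.
  by rewrite generic_assoc // => e; apply: rpq.
by subst q; rewrite ec_add_dbl.
Qed.

End Associativity.

(** The rational points as an abelian group of the algebraic hierarchy, so that
    multiples, sums and morphisms are available for them. *)
HB.instance Definition _ (E : elliptic_curve) := Choice.on (ec_point E).
HB.instance Definition _ (E : elliptic_curve) :=
  GRing.isZmodule.Build (ec_point E) (@ec_addA E) (@ec_addC E) (@ec_add0p E) (@ec_addNp E).

Section Group.
Variable E : elliptic_curve.
Implicit Types p q : ec_point E.

Lemma ec_addE p q : ec_add p q = p + q. Proof. by []. Qed.
Lemma ec_oppE p : ec_opp p = - p. Proof. by []. Qed.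
Lemma ec_zeroE : ec_zero E = 0. Proof. by []. Qed.

Lemma ec_mulnE n p : ec_muln n p = p *+ n.
Proof. by elim: n => //= n IH; rewrite mulrS -IH. Qed.

Lemma ec_mulzE n p : ec_mulz n p = p *~ n.
Proof. by case: n => n; rewrite /ec_mulz ec_mulnE. Qed.

Lemma ec_combE r (P : 'I_r -> ec_point E) n :
  ec_comb P n = \sum_(i < r) P i *~ n 0 i.
Proof. by apply: eq_bigr => i _; rewrite ec_mulzE. Qed.
End Group.

(** * Integral binary forms and heights *)

(** The homogenisation of degree n, evaluated at (a, d); it clears the denominator d
    of p.[a / d]. *)
Definition homog (n : nat) (p : {poly int}) (a d : int) : int :=
  \sum_(i < n.+1) p`_i * a ^+ i * d ^+ (n - i).

Lemma homog_rat n (p : {poly int}) (a d : int) : d != 0 -> (size p <= n.+1)%N ->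
  (homog n p a d)%:~R = d%:~R ^+ n * (map_poly intr p).[a%:~R / d%:~R] :> rat.
Proof.
move=> d0 sp; rewrite (@horner_coef_wide _ n.+1) ?(leq_trans (size_poly _ _)) //.
rewrite /homog rmorph_sum mulr_sumr; apply: eq_bigr => i _.
rewrite coef_map !rmorphM !rmorphXn /= expr_div_n.
have d0' : d%:~R != 0 :> rat by rewrite intr_eq0.
have -> : d%:~R ^+ n = d%:~R ^+ (n - i) * d%:~R ^+ i :> rat.
  by rewrite -exprD subnK // -ltnS.
by field; rewrite expf_neq0.
Qed.

Lemma homog_mul n m (p q : {poly int}) (a d : int) : d != 0 -> (size p <= n.+1)%N -> (size q <= m.+1)%N ->
  homog (n + m) (p * q) a d = homog n p a d * homog m q a d.
Proof.
move=> d0 sp sq; apply: (@intr_inj rat); rewrite rmorphM /= !homog_rat //.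
  by rewrite rmorphM hornerM exprD; ring.
apply: leq_trans (size_polyMleq _ _) _.
by have := leq_add sp sq; rewrite addSn addnS; case: (_ + _)%N.
Qed.

Lemma homogD n (p q : {poly int}) a d : homog n (p + q) a d = homog n p a d + homog n q a d.
Proof. by rewrite -big_split; apply: eq_bigr => i _; rewrite coefD !mulrDl. Qed.

Definition coef_norm n (p : {poly int}) : int := \sum_(i < n.+1) `|p`_i|.

Lemma homog_le n (p : {poly int}) (a d M : int) : `|a| <= M -> `|d| <= M ->
  `|homog n p a d| <= coef_norm n p * M ^+ n.
Proof.
move=> aM dM; rewrite /homog /coef_norm mulr_suml.
apply: le_trans (ler_norm_sum _ _ _) _; apply: ler_sum => i _.
have -> : M ^+ n = M ^+ i * M ^+ (n - i) by rewrite -exprD subnKC // -ltnS.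
rewrite !normrM -mulrA ler_wpM2l //.
by rewrite !normrX ler_pM ?exprn_ge0 ?lerXn2r ?nnegrE // (le_trans _ aM).
Qed.

Lemma coef_norm_ge0 n p : 0 <= coef_norm n p.
Proof. exact: sumr_ge0. Qed.

(** Coprime coordinates of a rational point of the projective line divide any
    integral coordinates of it. *)
Lemma coprimez_proportional (A B u v : int) : coprimez u v -> A * v = B * u ->
  exists k, A = k * u /\ B = k * v.
Proof.
case/coprimezP => -[r s] /= e h; exists (A * r + B * s); split.
  rewrite -{1}[A]mulr1 -e.
  have -> : A * (r * u + s * v) = A * r * u + A * v * s by ring.
  by rewrite h; ring.
have -> : (A * r + B * s) * v = A * v * r + B * s * v by ring.
by rewrite h -{1}[B]mulr1 -e; ring.
Qed.

(** A rational map of degree n whose homogeneous coordinates satisfy the two Bezout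
    identities multiplies the logarithmic height by n up to O(1) from below.  At
    (a, d) the identities have the values D1 d^(m+n) and D2 a^(m+n).  Hence
    the common factor k of the two coordinates divides D1 D2, and the larger of the
    coordinates is at least a constant times the n-th power of the larger of |a|, |d|. *)
Lemma homog_height_lower (F G f1 g1 f2 g2 : {poly int}) (D1 D2 : int) (n m : nat) :
    (size F <= n.+1)%N -> (size G <= n.+1)%N ->
    (size f1 <= m.+1)%N -> (size g1 <= m.+1)%N ->
    (size f2 <= m.+1)%N -> (size g2 <= m.+1)%N ->
    D1 != 0 -> D2 != 0 ->
    f1 * F + g1 * G = D1%:P -> f2 * F + g2 * G = D2 *: 'X^(m + n) ->
  exists2 c : int, 0 < c & forall a d u v : int, d != 0 -> coprimez a d -> coprimez u v ->
    homog n F a d * v = homog n G a d * u ->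
    Num.max `|a| `|d| ^+ n <= c * Num.max `|u| `|v|.
Proof.
move=> sF sG sf1 sg1 sf2 sg2 D10 D20 e1 e2.
pose C := coef_norm m f1 + coef_norm m g1 + coef_norm m f2 + coef_norm m g2 + 1.
have C0 : 0 < C by rewrite ltr_wpDl // !addr_ge0 // coef_norm_ge0.
exists (C * `|D1 * D2| * 2); first by rewrite !mulr_gt0 // normr_gt0 mulf_neq0.
move=> a d u v d0 cad cuv /(coprimez_proportional cuv) [k [kA kB]].
set H := Num.max `|a| `|d|; set h := Num.max `|u| `|v|.
have h1 : homog m f1 a d * (k * u) + homog m g1 a d * (k * v) = D1 * d ^+ (m + n).
  rewrite -kA -kB -!homog_mul // -homogD e1 /homog big_ord_recl /= coefC /= expr0 mulr1 subn0.
  by rewrite big1 ?addr0 // => i _; rewrite coefC /= !mul0r.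
have h2 : homog m f2 a d * (k * u) + homog m g2 a d * (k * v) = D2 * a ^+ (m + n).
  rewrite -kA -kB -!homog_mul // -homogD e2 /homog big_ord_recr /= coefZ coefXn eqxx mulr1 subnn mulr1.
  rewrite big1 ?add0r // => i _; rewrite coefZ coefXn /= (ltn_eqF (ltn_ord i)).
  by rewrite mulr0 !mul0r.
have kD : (k %| D1 * D2)%Z.
  have cc : coprimez (d ^+ (m + n)) (a ^+ (m + n)).
    by rewrite coprimezXl ?coprimezXr // coprimez_sym.
  case/coprimezP: cc => -[r s] /= rs.
  rewrite -[D1 * D2]mulr1 -rs.
  have -> : D1 * D2 * (r * d ^+ (m + n) + s * a ^+ (m + n)) =
    D2 * r * (D1 * d ^+ (m + n)) + D1 * s * (D2 * a ^+ (m + n)) by ring.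
  rewrite -h1 -h2; apply/dvdzP.
  exists (D2 * r * (homog m f1 a d * u + homog m g1 a d * v) +
          D1 * s * (homog m f2 a d * u + homog m g2 a d * v)); ring.
pose DD := `|D1 * D2|.
have kle : `|k| <= DD.
  have : D1 * D2 != 0 by rewrite mulf_neq0.
  rewrite /DD.
  case/dvdzP: kD => q ->; rewrite mulf_eq0 negb_or => /andP [q0 _].
  by rewrite normrM ler_peMl // -gtz0_ge1 normr_gt0.
have DD0 : 0 <= DD by exact: normr_ge0.
have H0 : 0 < H by rewrite lt_max; apply/orP; right; rewrite normr_gt0.
have h0 : 0 <= h by rewrite le_max normr_ge0.
have aH : `|a| <= H by rewrite le_max lexx.
have dH : `|d| <= H by rewrite le_max lexx orbT.
have uh : `|u| <= h by rewrite le_max lexx.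
have vh : `|v| <= h by rewrite le_max lexx orbT.
have comb f g : coef_norm m f + coef_norm m g <= C ->
   `|homog m f a d * (k * u) + homog m g a d * (k * v)| <= C * H ^+ m * (DD * h).
  move=> fgC; apply: le_trans (ler_normD _ _) _; rewrite !normrM.
  apply: (@le_trans _ _ ((coef_norm m f + coef_norm m g) * H ^+ m * (DD * h))).
    have t x w : `|w| <= h ->
        `|homog m x a d| * (`|k| * `|w|) <= coef_norm m x * H ^+ m * (DD * h).
      by move=> wh; rewrite ler_pM ?mulr_ge0 ?homog_le // ler_pM.
    by rewrite !mulrDl lerD // t.
  by rewrite ler_wpM2r ?mulr_ge0 // ler_wpM2r // exprn_ge0 // ltW.
have big : H ^+ (m + n) <= C * H ^+ m * (DD * h).
  have /orP [/eqP e|/eqP e] : (H == `|a|) || (H == `|d|).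
  - by rewrite /H; case: (leP `|a| `|d|) => _; rewrite eqxx ?orbT.
  - rewrite {1}e; apply: (le_trans _ (comb f2 g2 _)).
      by rewrite h2 normrM normrX ler_peMl ?exprn_ge0 // -gtz0_ge1 normr_gt0.
    by have := coef_norm_ge0 m f1; have := coef_norm_ge0 m g1; rewrite /C; lra.
  rewrite {1}e; apply: (le_trans _ (comb f1 g1 _)).
    by rewrite h1 normrM normrX ler_peMl ?exprn_ge0 // -gtz0_ge1 normr_gt0.
  by have := coef_norm_ge0 m f2; have := coef_norm_ge0 m g2; rewrite /C; lra.
rewrite -(ler_pM2l (exprn_gt0 m H0)) -exprD; apply: le_trans big _.
have -> : C * H ^+ m * (DD * h) = H ^+ m * (C * DD * h) by ring.
rewrite ler_pM2l ?exprn_gt0 //.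
have : 0 <= C * DD * h by rewrite !mulr_ge0 // ltW.
by lra.
Qed.

(** The coefficients of a product of two linear forms are not much smaller than the
    product of the heights of the forms. *)
Lemma height_mul_le (u v u' v' M : int) :
    `|u * u'| <= M -> `|v * v'| <= M -> `|u * v' + u' * v| <= M ->
  Num.max `|u| `|v| * Num.max `|u'| `|v'| <= 2 * M.
Proof.
move=> h1 h2 h3; have M0 : 0 <= M by apply: le_trans h1.
have cross (x y : int) : `|x * y| <= M ^+ 2 -> `|x + y| <= M -> `|x| <= 2 * M.
  move=> xy s; have xM : `|x| <= M + `|y|.
    by rewrite -[x](addrK y) (le_trans (ler_normB _ _)) // lerD2r.
  rewrite normrM in xy; have := normr_ge0 x; have := normr_ge0 y; move: xM xy.
  move: (`|x|) (`|y|) => X Y xM xy X0 Y0; rewrite leNgt; apply/negP => lt.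
  nra.
have xy : `|(u * v') * (u' * v)| <= M ^+ 2.
  have -> : (u * v') * (u' * v) = (u * u') * (v * v') by ring.
  by rewrite normrM expr2 ler_pM.
have c1 := cross _ _ xy h3.
have c2 : `|u' * v| <= 2 * M by apply: (cross _ (u * v')); rewrite 1?[X in `|X|]mulrC // addrC.
rewrite !normrM in h1 h2 c1 c2.
case: (leP `|u| `|v|) => _; case: (leP `|u'| `|v'|) => _; move: h1 h2 c1 c2; lra.
Qed.

(** Gauss's lemma for two linear forms.  Modulo the ideal of the three coefficients,
    the products u v' and v u' have square zero and product zero, so the square of
    (a u + b v) (a' u' + b' v') = 1, expanded in terms of them, lies in the ideal. *)
Lemma primitive_triple (u v u' v' : int) : coprimez u v -> coprimez u' v' ->
  exists r s t, r * (v * v') + s * (u * v' + u' * v) + t * (u * u') = 1.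
Proof.
case/coprimezP => -[a b] /= e; case/coprimezP => -[a' b'] /= e'.
pose i := a * a' * (u * u') + b * b' * (v * v').
pose al := a * b'; pose be := b * a'; pose X := u * v'; pose Y := v * u'.
pose w := i + 2 * al * X + 2 * be * Y.
exists (b * b' * w), (al ^+ 2 * X + be ^+ 2 * Y),
  (a * a' * w + (2 * al * be - al ^+ 2 - be ^+ 2) * (v * v')).
transitivity (((a * u + b * v) * (a' * u' + b' * v')) ^+ 2); last by rewrite e e' mulr1 expr1n.
rewrite /w /i /al /be /X /Y; ring.
Qed.

(** A primitive integral vector divides every integral vector proportional to it. *)
Lemma triple_proportional (A S T al be ga : int) :
    (exists r s t, r * al + s * be + t * ga = 1) ->
    A * be = S * al -> A * ga = T * al -> S * ga = T * be ->
  exists k, [/\ A = k * al, S = k * be & T = k * ga].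
Proof.
case=> r [s [t e]] h1 h2 h3; exists (A * r + S * s + T * t); split.
- have -> : (A * r + S * s + T * t) * al = A * al * r + (S * al) * s + (T * al) * t by ring.
  by rewrite -h1 -h2 -{1}[A]mulr1 -e; ring.
- have -> : (A * r + S * s + T * t) * be = (A * be) * r + S * be * s + (T * be) * t by ring.
  by rewrite h1 -h3 -{1}[S]mulr1 -e; ring.
have -> : (A * r + S * s + T * t) * ga = (A * ga) * r + (S * ga) * s + T * ga * t by ring.
by rewrite h2 h3 -{1}[T]mulr1 -e; ring.
Qed.

(** If A, S, T are proportional to 1, the sum and the product of u / v and u' / v',
    then they bound the product of the heights of these two points.  The statement
    is projective in each of the points, so v or v' may be 0. *)
Lemma pair_height_upper (u v u' v' A S T M : int) : coprimez u v -> coprimez u' v' ->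
    (A, S, T) != (0, 0, 0) ->
    A * (u * v' + u' * v) = S * (v * v') -> A * (u * u') = T * (v * v') ->
    S * (u * u') = T * (u * v' + u' * v) ->
    `|A| <= M -> `|S| <= M -> `|T| <= M ->
  Num.max `|u| `|v| * Num.max `|u'| `|v'| <= 2 * M.
Proof.
move=> c c' nz h1 h2 h3 AM SM TM.
have [k [eA eS eT]] := triple_proportional (primitive_triple c c') h1 h2 h3.
have k0 : k != 0.
  by apply: contraNneq nz => k0; rewrite eA eS eT k0 !mul0r.
have kb x : `|x| <= `|k * x| by rewrite normrM ler_peMl // -gtz0_ge1 normr_gt0.
by apply: height_mul_le; apply: le_trans (kb _) _; rewrite -?eA -?eS -?eT.
Qed.

Lemma clear_denominators (s : seq {poly rat}) :
  exists2 N : int, N != 0 & forall i, (i < size s)%N ->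
    exists2 q : {poly int}, map_poly intr q = N%:~R *: s`_i & size q = size s`_i.
Proof.
suff [N N0 IH] : exists2 N : int, N != 0 & forall p, p \in s ->
    exists2 q : {poly int}, map_poly intr q = N%:~R *: p & size q = size p.
  by exists N => // i si; apply: IH; apply: mem_nth.
elim: s => [|p s [N N0 IH]]; first by exists 1.
have [q [a a0 pE]] := rat_poly_scale p.
have sz (c : int) (r : {poly int}) : c != 0 -> size (c *: r) = size r by move=> ?; rewrite size_scale.
have szq (r : {poly int}) : size (map_poly intr r : {poly rat}) = size r.
  by rewrite size_map_inj_poly //; exact: intr_inj.
exists (a * N); first by rewrite mulf_neq0.
move=> r; rewrite inE => /predU1P [->|/IH [q' e sq']].
  have qE : map_poly intr (N *: q) = (a * N)%:~R *: p.
    rewrite map_polyZ pE scalerA rmorphM /= mulrAC mulfV ?mul1r //.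
    by rewrite intr_eq0.
  exists (N *: q) => //; rewrite -szq qE size_scale //.
  by rewrite intr_eq0 mulf_neq0.
exists (a *: q'); last by rewrite sz.
by rewrite map_polyZ e scalerA -rmorphM.
Qed.

(** * Weil height under duplication and addition *)

Section Duplication.
Variable W : weierstrass.
Local Notation b2 := (wb2 W).
Local Notation b4 := (wb4 W).
Local Notation b6 := (wb6 W).
Local Notation b8 := (wb8 W).

(** The abscissa of 2 P is dbl_num / dbl_den evaluated at the abscissa of P. *)
Definition dbl_num : {poly rat} := Poly [:: - b8; - (2 * b6); - b4; 0; 1].
Definition dbl_den : {poly rat} := Poly [:: b6; 2 * b4; b2; 4].

Lemma wb8_rel : 4 * b8 = b2 * b6 - b4 ^+ 2.
Proof. by rewrite /wb8 /wb2 /wb4 /wb6; ring. Qed.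

(** This identity and the next one exhibit the discriminant times 1 and X^7 as
    combinations of the numerator and the denominator: the two have no common zero on the
    projective line, the point at infinity included. *)
Lemma dbl_bezout1 : Poly [:: b2 ^+ 2 - 32 * b4; - (8 * b2); - 48] * dbl_num
   + Poly [:: b2 * b4 - 27 * b6; - (10 * b4); - b2; 12] * dbl_den = (wdisc W)%:P.
Proof.
rewrite /dbl_num /dbl_den /= !cons_poly_def /wdisc.
have -> : b8 = (b2 / 4) * b6 - (b4 / 2) ^+ 2.
  by apply: (@mulfI _ 4) => //; rewrite wb8_rel; field.
have -> : b2 = 4 * (b2 / 4) by field.
have -> : b4 = 2 * (b4 / 2) by field.
set e2 := b2 / 4; set e4 := b4 / 2.
have -> : 4 * e2 / 4 = e2 by field.
have -> : 2 * e4 / 2 = e4 by field.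
move: e2 e4 b6 => e2 e4 e6.
ring.
Qed.

(** Found by solving the linear system for the unknown coefficients, which are
    isobaric in b2, b4, b6.  The variables e2 = b2 / 4 and e4 = b4 / 2 make the
    relation 4 b8 = b2 b6 - b4^2 integral. *)
Definition bezout2_num : {poly rat} := let e2 := b2 / 4 in let e4 := b4 / 2 in
  Poly [:: - (12 * e4 ^+ 3 * b6) + 12 * e2 * e4 * b6 ^+ 2 - 6 * b6 ^+ 3;
    - (48 * e4 ^+ 4) + 52 * e2 * e4 ^+ 2 * b6 - 4 * e2 ^+ 2 * b6 ^+ 2 - 22 * e4 * b6 ^+ 2;
    - (32 * e2 * e4 ^+ 3) + 32 * e2 ^+ 2 * e4 * b6 + 4 * e4 ^+ 2 * b6 - 20 * e2 * b6 ^+ 2;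
    16 * e2 ^+ 2 * e4 ^+ 2 - 64 * e4 ^+ 3 - 16 * e2 ^+ 3 * b6 + 72 * e2 * e4 * b6 - 27 * b6 ^+ 2].
Definition bezout2_den : {poly rat} := let e2 := b2 / 4 in let e4 := b4 / 2 in
  Poly [:: 12 * e4 ^+ 5 - 24 * e2 * e4 ^+ 3 * b6 + 12 * e2 ^+ 2 * e4 * b6 ^+ 2 + 6 * e4 ^+ 2 * b6 ^+ 2 - 6 * e2 * b6 ^+ 3;
    - (4 * e2 * e4 ^+ 4) + 8 * e2 ^+ 2 * e4 ^+ 2 * b6 - 26 * e4 ^+ 3 * b6 - 4 * e2 ^+ 3 * b6 ^+ 2 + 26 * e2 * e4 * b6 ^+ 2 - 12 * b6 ^+ 3;
    - (20 * e4 ^+ 4) + 24 * e2 * e4 ^+ 2 * b6 - 4 * e2 ^+ 2 * b6 ^+ 2 - 8 * e4 * b6 ^+ 2;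
    8 * e2 * e4 ^+ 3 - 8 * e2 ^+ 2 * e4 * b6 - e4 ^+ 2 * b6 + 5 * e2 * b6 ^+ 2].

Lemma dbl_bezout2 :
  bezout2_num * dbl_num + bezout2_den * dbl_den = (wdisc W)%:P * 'X^7.
Proof.
rewrite /bezout2_num /bezout2_den /dbl_num /dbl_den /= !cons_poly_def /wdisc.
have -> : b8 = (b2 / 4) * b6 - (b4 / 2) ^+ 2.
  by apply: (@mulfI _ 4) => //; rewrite wb8_rel; field.
have e2E : b2 = 4 * (b2 / 4) by field.
have e4E : b4 = 2 * (b4 / 2) by field.
move: e2E e4E; set e2 := b2 / 4; set e4 := b4 / 2 => -> ->.
move: e2 e4 b6 => e2 e4 e6; ring.
Qed.

End Duplication.

Section Heights.
Variable E : elliptic_curve.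
Local Notation b2 := (wb2 E).
Local Notation b4 := (wb4 E).
Local Notation b6 := (wb6 E).
Local Notation b8 := (wb8 E).
Implicit Types p q : ec_point E.

(** Coprime homogeneous coordinates of the abscissa, equal to (1 : 0) at the origin. *)
Definition xnum p : int := if val p is Some (x, _) then numq x else 1.
Definition xden p : int := if val p is Some (x, _) then denq x else 0.
Definition xheight p : int := Num.max `|xnum p| `|xden p|.

Lemma coprime_x p : coprimez (xnum p) (xden p).
Proof.
rewrite /xnum /xden; case: (val p) => [[x y]|] //=.
by rewrite coprimezE coprime_num_den.
Qed.

Lemma xheight_ge1 p : 1 <= xheight p.
Proof.
rewrite /xheight /xnum /xden; case: (val p) => [[x y]|] //=.
by rewrite le_max -!gtz0_ge1 !normr_gt0 denq_neq0 orbT.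
Qed.

Lemma weil_heightE (R : realType) p : weil_height R (ec_x p) = ln (xheight p)%:~R.
Proof.
rewrite /ec_x /xheight /xnum /xden; case: (val p) => [[x y]|] /=.
  by rewrite (gtr0_norm (denq_gt0 x)).
by rewrite normr1 normr0 max_l // ln1.
Qed.

Lemma xheightN p : xheight (- p) = xheight p.
Proof. by rewrite /xheight /xnum /xden /=; case: (val p) => [[x y]|]. Qed.

Lemma xnumE p x y : val p = Some (x, y) -> ((xnum p)%:~R = x * (xden p)%:~R) /\ xden p != 0.
Proof. by rewrite /xnum /xden => ->; rewrite denq_neq0 numqE. Qed.

(** Written projectively, the duplication formula also holds when 2 P is the
    origin. *)
Lemma dbl_abscissa p x y : val p = Some (x, y) ->
  (dbl_num E).[x] * (xden (p + p))%:~R = (dbl_den E).[x] * (xnum (p + p))%:~R.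
Proof.
move=> pE; have /= := valP p; rewrite pE => o.
have den : (dbl_den E).[x] = (2 * y + wa1 E * x + wa3 E) ^+ 2.
  rewrite /dbl_den horner_Poly /= /wb2 /wb4 /wb6.
  move: o => /=; rewrite eq_sym -subr_eq0 => /eqP o; apply/eqP; rewrite -subr_eq0.
  by apply/eqP; rewrite -[RHS](mulr0 4) -[in RHS]o; ring.
have [h|h] := eqVneq y (- y - wa1 E * x - wa3 E).
  have h0 : 2 * y + wa1 E * x + wa3 E = 0 by rewrite mulr2n mulrDl mul1r {2}h; ring.
  rewrite den h0 expr0n /= mul0r.
  by rewrite /xden /= pE /= eqxx -h eqxx /= mulr0.
case ppE : (val (p + p)) => [[x3 y3]|]; last first.
  by move: ppE; rewrite /= pE /= eqxx (negbTE h).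
have [-> _] := xnumE ppE; rewrite mulrA; congr (_ * _).
have [_ d] := tangent_case o o h.
move: ppE; rewrite /= pE /= eqxx (negbTE h) /= => -[<- _].
rewrite den /ec_slope eqxx /dbl_num horner_Poly /= /wb4 /wb6 /wb8.
move: o d => /= /eqP; move: (wa1 E) (wa2 E) (wa3 E) (wa4 E) (wa6 E) => a1 a2 a3 a4 a6 o d.
have -> : a6 = y ^+ 2 + a1 * x * y + a3 * y - (x ^+ 3 + a2 * x ^+ 2 + a4 * x) by rewrite o; ring.
by field.
Qed.

(** The numerators of the sum and of the product of the abscissae of P + Q and P - Q,
    over the common denominator (x1 - x2)^2. *)
Definition sum_coef (x1 x2 : rat) : rat :=
  2 * x1 * x2 * (x1 + x2) + b2 * x1 * x2 + b4 * (x1 + x2) + b6.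
Definition prod_coef (x1 x2 : rat) : rat :=
  x1 ^+ 2 * x2 ^+ 2 - b4 * x1 * x2 - b6 * (x1 + x2) - b8.

Lemma addB_abscissa p q x1 y1 x2 y2 x3 y3 x4 y4 :
    val p = Some (x1, y1) -> val q = Some (x2, y2) -> x1 != x2 ->
    val (p + q) = Some (x3, y3) -> val (p - q) = Some (x4, y4) ->
  (x1 - x2) ^+ 2 * (x3 + x4) = sum_coef x1 x2 /\
  (x1 - x2) ^+ 2 * (x3 * x4) = prod_coef x1 x2.
Proof.
move=> pE qE ne; rewrite /= pE qE /= (negbTE ne) /= => -[<- _] [<- _].
have /= := valP p; rewrite pE => /eqP o1; have /= := valP q; rewrite qE => /eqP o2.
rewrite /ec_slope (negbTE ne).
have d : x2 - x1 != 0 by rewrite subr_eq0 eq_sym.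
rewrite /sum_coef /prod_coef /wb2 /wb4 /wb6 /wb8.
move: (wa1 E) (wa2 E) (wa3 E) (wa4 E) (wa6 E) o1 o2 => a1 a2 a3 a4 a6 o1 o2.
have e6 : a6 = y1 ^+ 2 + a1 * x1 * y1 + a3 * y1 - (x1 ^+ 3 + a2 * x1 ^+ 2 + a4 * x1) by rewrite o1; ring.
have -> : a6 = y1 ^+ 2 + a1 * x1 * y1 + a3 * y1 - (x1 ^+ 3 + a2 * x1 ^+ 2 + a4 * x1) by [].
have -> : a4 = ((y2 ^+ 2 + a1 * x2 * y2 + a3 * y2 - x2 ^+ 3 - a2 * x2 ^+ 2) -
    (y1 ^+ 2 + a1 * x1 * y1 + a3 * y1 - x1 ^+ 3 - a2 * x1 ^+ 2)) / (x2 - x1).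
  apply: (mulIf d); rewrite divfK //.
  have -> : y2 ^+ 2 + a1 * x2 * y2 + a3 * y2 - x2 ^+ 3 - a2 * x2 ^+ 2 = a4 * x2 + a6.
    by rewrite o2; ring.
  by rewrite e6; ring.
by split; field.
Qed.


(** The Bezout identities are cleared of denominators by a common factor N, so their
    right-hand sides become N d0 with d0 the value of N times the discriminant. *)
Lemma xheight_dbl_lower :
  exists2 c : int, 0 < c & forall p, xheight p ^+ 4 <= c * xheight (p + p).
Proof.
have [N N0 cl] := clear_denominators [:: dbl_num E; dbl_den E;
  Poly [:: b2 ^+ 2 - 32 * b4; - (8 * b2); - 48];
  Poly [:: b2 * b4 - 27 * b6; - (10 * b4); - b2; 12];
  bezout2_num E; bezout2_den E; (wdisc E)%:P].
have [F hF sF] := cl 0 isT.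
have [G hG sG] := cl 1 isT.
have [f1 hf1 sf1] := cl 2 isT.
have [g1 hg1 sg1] := cl 3 isT.
have [f2 hf2 sf2] := cl 4 isT.
have [g2 hg2 sg2] := cl 5 isT.
have [D hD sD] := cl 6 isT.
rewrite /= in hF sF hG sG hf1 sf1 hg1 sg1 hf2 sf2 hg2 sg2 hD sD.
have inj : injective (map_poly (intr : int -> rat)).
  by apply: map_inj_poly => //; exact: intr_inj.
have {sD} [d0 DE] : exists d : int, D = d%:P.
  by exists D`_0; apply: size1_polyC; rewrite sD size_polyC; case: (_ != _).
have dE : d0%:~R = N%:~R * wdisc E.
  by apply: polyC_inj; rewrite -map_polyC -DE hD polyCM mul_polyC.
have d00 : d0 != 0.
  by rewrite -(intr_eq0 rat) dE mulf_neq0 ?intr_eq0 // ec_smooth.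
have e1 : f1 * F + g1 * G = (N * d0)%:P.
  apply: inj; rewrite rmorphD !rmorphM /= hf1 hg1 hF hG -!scalerAl -!scalerAr -!scalerDr.
  by rewrite dbl_bezout1 !map_polyC /= dE -!mul_polyC !polyCM.
have e2 : f2 * F + g2 * G = (N * d0) *: 'X^7.
  apply: inj; rewrite map_polyZ map_polyXn rmorphD !rmorphM /= hf2 hg2 hF hG -!scalerAl -!scalerAr -!scalerDr.
  by rewrite dbl_bezout2 dE -!mul_polyC !polyCM !mulrA.
have sP (l : seq rat) n : (size l <= n)%N -> (size (Poly l) <= n)%N by exact: leq_trans (size_Poly _).
have zF : (size F <= 5)%N by rewrite sF sP.
have zG : (size G <= 5)%N by rewrite sG sP.
have zf1 : (size f1 <= 4)%N by rewrite sf1; apply: leq_trans (size_Poly [:: _; _; _]) _.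
have zg1 : (size g1 <= 4)%N by rewrite sg1; apply: leq_trans (size_Poly [:: _; _; _; _]) _.
have zf2 : (size f2 <= 4)%N by rewrite sf2 sP.
have zg2 : (size g2 <= 4)%N by rewrite sg2 sP.
have [] := @homog_height_lower F G f1 g1 f2 g2 (N * d0) (N * d0) 4 3; rewrite ?mulf_neq0 //.

move=> c c0 H; exists c => // p.
case pE : (val p) => [[x y]|]; last first.
  have -> : p = 0 by exact: val_inj.
  by rewrite addr0 /xheight /xnum /xden /= normr1 normr0 max_l // expr1n mulr1 -gtz0_ge1.
have [xE xd0] := xnumE pE.
apply: H (coprime_x p) (coprime_x _) _ => //.
apply: (@intr_inj rat); rewrite !rmorphM /= !homog_rat ?sF ?sG //; try exact: sP.
have xd : (xden p)%:~R != 0 :> rat by rewrite intr_eq0.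
rewrite xE mulfK // hF hG !hornerZ.
have := dbl_abscissa pE.
move: (dbl_num E).[x] (dbl_den E).[x] (_ (xden (p + p))) (_ (xnum (p + p))) => a b u v h.
transitivity ((xden p)%:~R ^+ 4 * N%:~R * (a * u)); first by ring.
by rewrite h; ring.
Qed.

(** So the addition formulas still determine points of the projective line when
    x1 = x2, where their common denominator vanishes. *)
Lemma dbl_coprime x : ~~ ((dbl_den E).[x] == 0) || ~~ ((dbl_num E).[x] == 0).
Proof.
rewrite -negb_and; apply/negP => /andP [/eqP d /eqP n].
have := dbl_bezout1 E => /(congr1 (horner^~ x)); rewrite hornerD !hornerM hornerC d n !mulr0 addr0.
by move/eqP; rewrite eq_sym (negbTE (ec_smooth E)).
Qed.

(** The three coefficients are proportional to those of the product of the two linear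
    forms that vanish at the abscissae of P + Q and P - Q.  When x1 = x2, one of
    these points is the origin, the other is a double, and the formulas specialise
    to the duplication formula. *)
Lemma addB_coord p q x1 y1 x2 y2 :
    val p = Some (x1, y1) -> val q = Some (x2, y2) ->
  let A := (x1 - x2) ^+ 2 in let S := sum_coef x1 x2 in let T := prod_coef x1 x2 in
  let u := (xnum (p + q))%:~R in let v := (xden (p + q))%:~R in
  let u' := (xnum (p - q))%:~R in let v' := (xden (p - q))%:~R in
  [/\ (A, S, T) != (0, 0, 0), A * (u * v' + u' * v) = S * (v * v'),
      A * (u * u') = T * (v * v') & S * (u * u') = T * (u * v' + u' * v)].
Proof.
move=> pE qE A S T u v u' v'.
have [e|ne] := eqVneq x1 x2; last first.
  case sE : (val (p + q)) => [[x3 y3]|]; last by move: sE; rewrite /= pE qE /= (negbTE ne).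
  case dE : (val (p - q)) => [[x4 y4]|]; last by move: dE; rewrite /= pE qE /= (negbTE ne).
  have [hS hT] := addB_abscissa pE qE ne sE dE.
  have [hu _] := xnumE sE; have [hu' _] := xnumE dE.
  split; first by apply/eqP => -[/eqP]; rewrite /A expf_eq0 subr_eq0 (negbTE ne).
  - by rewrite /S -hS /u /u' hu hu'; rewrite -/A -/v -/v'; ring.
  - by rewrite /T -hT /u /u' hu hu'; rewrite -/A -/v -/v'; ring.
  by rewrite /S -hS /T -hT /u /u' hu hu'; rewrite -/A -/v -/v'; ring.
have SE : S = (dbl_den E).[x1].
  by rewrite /S /sum_coef -e /dbl_den horner_Poly /=; ring.
have TE : T = (dbl_num E).[x1].
  by rewrite /T /prod_coef -e /dbl_num horner_Poly /=; ring.
have A0 : A = 0 by rewrite /A e subrr expr0n.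
have nz : (A, S, T) != (0, 0, 0).
  by apply/eqP => -[_ s t]; have := dbl_coprime x1; rewrite -SE -TE s t eqxx.
have dbl := dbl_abscissa pE; rewrite -SE -TE in dbl.
have [qp|qp] : q = p \/ q = - p.
  have oq := valP q; have op := valP p; rewrite qE -e in oq; rewrite pE in op.
  have [h|h] := same_abscissa op oq; [left|right]; apply: val_inj; rewrite /= qE pE -e h //.
- have u'E : u' = 1 by rewrite /u' qp subrr.
  have v'E : v' = 0 by rewrite /v' qp subrr.
  split=> //; rewrite ?(A0, u'E, v'E, mulr0, mul0r, add0r, mulr1, mul1r) //.
  by rewrite /u /v qp dbl.
have uE : u = 1 by rewrite /u qp subrr.
have vE : v = 0 by rewrite /v qp subrr.
split=> //; rewrite ?(A0, uE, vE, mulr0, mul0r, addr0, mulr1, mul1r) //.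
by rewrite /u' /v' qp opprK dbl.
Qed.

(** Upper half of the parallelogram law.  After clearing denominators the three
    coefficients are integral forms of degree 2 in the coordinates of each of P and
    Q, which bounds them by a constant times H(P)^2 H(Q)^2. *)
Lemma xheight_add_upper : exists2 c : int, 0 < c &
  forall p q, xheight (p + q) * xheight (p - q) <= c * xheight p ^+ 2 * xheight q ^+ 2.
Proof.
have [N N0 cl] := clear_denominators [:: b2%:P; b4%:P; b6%:P; b8%:P].
have {}cl i : (i < 4)%N -> exists B : int, B%:~R = N%:~R * [:: b2; b4; b6; b8]`_i.
  move=> i4; have [q] := cl i i4; rewrite (_ : [:: _; _; _; _]`_i = ([:: b2; b4; b6; b8]`_i)%:P); last first.
    by case: i i4 => [|[|[|[]]]].
  move: (_`_i) => b e sq; exists q`_0; apply: polyC_inj; rewrite -map_polyC -size1_polyC.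
    by rewrite e polyCM mul_polyC.
  by rewrite sq size_polyC; case: (_ != _).
have [B2 e2] := cl 0 isT.
have [B4 e4] := cl 1 isT.
have [B6 e6] := cl 2 isT.
have [B8 e8] := cl 3 isT.
pose K := `|N| + `|B2| + `|B4| + `|B6| + `|B8|.
have N1 : 1 <= `|N| by rewrite -gtz0_ge1 normr_gt0.
have K1 : 1 <= K.
  by rewrite /K; have := normr_ge0 B2; have := normr_ge0 B4; have := normr_ge0 B6; have := normr_ge0 B8; lra.
exists (8 * K); first by lra.
move=> p q.
have hp1 : 1 <= xheight p ^+ 2 by rewrite exprn_ege1 // xheight_ge1.
have hq1 : 1 <= xheight q ^+ 2 by rewrite exprn_ege1 // xheight_ge1.
case pE : (val p) => [[x1 y1]|]; last first.
  have -> : p = 0 by exact: val_inj.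
  have -> : xheight (0 : ec_point E) = 1 by rewrite /xheight /xnum /xden /= normr1 normr0 max_l.
  rewrite add0r sub0r xheightN expr1n mulr1 -expr2.
  by rewrite ler_peMl // ?(le_trans _ hq1) //; lra.
case qE : (val q) => [[x2 y2]|]; last first.
  have -> : q = 0 by exact: val_inj.
  have -> : xheight (0 : ec_point E) = 1 by rewrite /xheight /xnum /xden /= normr1 normr0 max_l.
  rewrite addr0 subr0 expr1n mulr1 -expr2.
  by rewrite ler_peMl // ?(le_trans _ hp1) //; lra.
have [xE xd0] := xnumE pE; have [zE zd0] := xnumE qE.
have := addB_coord pE qE.
set A := _ ^+ 2; set S := sum_coef _ _; set T := prod_coef _ _ => /= -[nz h1 h2 h3].
move: xE xd0 zE zd0 hp1 hq1.
rewrite /xheight; have := coprime_x (p + q); have := coprime_x (p - q).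
move: (xnum p) (xden p) (xnum q) (xden q) => a1 d1 a2 d2.
move: h1 h2 h3; move: (xnum (p + q)) (xden (p + q)) (xnum (p - q)) (xden (p - q)).
move=> u v u' v' h1 h2 h3 c' c xE d10 zE d20.
set H1 := Num.max `|a1| `|d1|; set H2 := Num.max `|a2| `|d2| => hp1 hq1.
(* the factor that turns (x1 - x2)^2 and the two numerators into integers *)
pose Z : int := N * d1 ^+ 2 * d2 ^+ 2.
have Z0 : Z%:~R != 0 :> rat by rewrite intr_eq0 /Z !mulf_neq0 ?expf_neq0.
pose A' : int := N * (a1 * a1 * d2 * d2) - N * 2 * (a1 * d1 * a2 * d2) + N * (d1 * d1 * a2 * a2).
pose S' : int := N * 2 * (a1 * a1 * a2 * d2) + N * 2 * (a1 * d1 * a2 * a2)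
  + B2 * (a1 * d1 * a2 * d2) + B4 * (a1 * d1 * d2 * d2) + B4 * (d1 * d1 * a2 * d2)
  + B6 * (d1 * d1 * d2 * d2).
pose T' : int := N * (a1 * a1 * a2 * a2) - B4 * (a1 * d1 * a2 * d2)
  - B6 * (a1 * d1 * d2 * d2) - B6 * (d1 * d1 * a2 * d2) - B8 * (d1 * d1 * d2 * d2).
have AE : A'%:~R = Z%:~R * A.
  by rewrite /A' /Z /A !(intrD, intrM, mulrNz, rmorphXn) /= xE zE; ring.
have SE : S'%:~R = Z%:~R * S.
  by rewrite /S' /Z /S /sum_coef !(intrD, intrM, mulrNz, rmorphXn) /= xE zE e2 e4 e6 /=; ring.
have TE : T'%:~R = Z%:~R * T.
  by rewrite /T' /Z /T /prod_coef !(intrD, intrM, mulrNz, rmorphXn) /= xE zE e4 e6 e8 /=; ring.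
clearbody Z A S T.
pose P := H1 ^+ 2 * H2 ^+ 2.
have H1a : `|a1| <= H1 by rewrite le_max lexx.
have H1d : `|d1| <= H1 by rewrite le_max lexx orbT.
have H2a : `|a2| <= H2 by rewrite le_max lexx.
have H2d : `|d2| <= H2 by rewrite le_max lexx orbT.
have mono x y z t : `|x| <= H1 -> `|y| <= H1 -> `|z| <= H2 -> `|t| <= H2 ->
    `|x * y * z * t| <= P.
  move=> hx hy hz ht; rewrite !normrM /P !expr2 mulrA.
  by rewrite ler_pM ?mulr_ge0 // ler_pM ?mulr_ge0 // ler_pM.
have term B x y z t : `|x| <= H1 -> `|y| <= H1 -> `|z| <= H2 -> `|t| <= H2 ->
    `|B * (x * y * z * t)| <= `|B| * P.
  by move=> hx hy hz ht; rewrite normrM ler_wpM2l // mono.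
have P0 : 0 <= P by rewrite mulr_ge0 // (le_trans ler01).
have Z2 : `|N * 2| = 2 * `|N| by rewrite normrM mulrC.
have nadd (x y c1 c2 : int) : `|x| <= c1 -> `|y| <= c2 -> `|x + y| <= c1 + c2.
  by move=> hx hy; apply: le_trans (ler_normD _ _) _; exact: lerD.
have nsub (x y c1 c2 : int) : `|x| <= c1 -> `|y| <= c2 -> `|x - y| <= c1 + c2.
  by move=> hx hy; apply: nadd => //; rewrite normrN.
pose n := `|N| * P; pose b2' := `|B2| * P; pose b4' := `|B4| * P.
pose b6' := `|B6| * P; pose b8' := `|B8| * P.
have term2 x y z t : `|x| <= H1 -> `|y| <= H1 -> `|z| <= H2 -> `|t| <= H2 ->
    `|N * 2 * (x * y * z * t)| <= 2 * n.
  by move=> hx hy hz ht; rewrite /n mulrA -Z2 term.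
have bA : `|A'| <= n + 2 * n + n by apply: nadd; [apply: nsub|]; first [exact: term2|exact: term].
have bS : `|S'| <= 2 * n + 2 * n + b2' + b4' + b4' + b6'.
  by repeat first [exact: (term2)|exact: (term)|apply: (nadd)].
have bT : `|T'| <= n + b4' + b6' + b6' + b8'.
  by repeat first [exact: (term)|apply: (nsub)].
have -> : 8 * K * H1 ^+ 2 * H2 ^+ 2 = 2 * (4 * (n + b2' + b4' + b6' + b8')).
  by rewrite /n /b2' /b4' /b6' /b8' /K /P; ring.
have pos (B : int) : 0 <= `|B| * P by rewrite mulr_ge0.
move: (pos N) (pos B2) (pos B4) (pos B6) (pos B8) bA bS bT.
rewrite -/n -/b2' -/b4' -/b6' -/b8'; clearbody n b2' b4' b6' b8'.
move=> pn p2 p4 p6 p8 bA bS bT.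
have wA : n + 2 * n + n <= 4 * (n + b2' + b4' + b6' + b8') by clear -pn p2 p4 p6 p8; lra.
have wS : 2 * n + 2 * n + b2' + b4' + b4' + b6' <= 4 * (n + b2' + b4' + b6' + b8').
  by clear -pn p2 p4 p6 p8; lra.
have wT : n + b4' + b6' + b6' + b8' <= 4 * (n + b2' + b4' + b6' + b8').
  by clear -pn p2 p4 p6 p8; lra.
apply: (@pair_height_upper _ _ _ _ A' S' T') => //.
- have zz (m : int) (x : rat) : m%:~R = Z%:~R * x -> m = 0 -> x = 0.
    by move=> h m0; apply: (mulfI Z0); rewrite -h m0 mulr0.
  by apply: contraNneq nz => -[/(zz _ _ AE) -> /(zz _ _ SE) -> /(zz _ _ TE) ->].
- by apply: (@intr_inj rat); rewrite [LHS]intrM [RHS]intrM AE SE !(intrM, intrD) -!mulrA h1.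
- by apply: (@intr_inj rat); rewrite [LHS]intrM [RHS]intrM AE TE !(intrM, intrD) -!mulrA h2.
- by apply: (@intr_inj rat); rewrite [LHS]intrM [RHS]intrM SE TE !(intrM, intrD) -!mulrA h3.
- exact: le_trans bA wA.
- exact: le_trans bS wS.
exact: le_trans bT wT.
Qed.

End Heights.

(** * The canonical height as a quadratic form *)

(** Tate's limit for a function on an abelian group that satisfies the upper half of
    the parallelogram law and the lower half of the duplication law up to constants. *)
Section Tate.
Variables (R : realType) (M : zmodType) (h : M -> R) (C1 C2 : R).
Hypothesis h_ge0 : forall p, 0 <= h p.
Hypothesis h_add : forall p q, h (p + q) + h (p - q) <= 2 * h p + 2 * h q + C1.
Hypothesis h_dbl : forall p, 4 * h p <= h (p + p) + C2.

Let C := `|C1| + `|C2|.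
Let tate p n : R := h (p *+ 2 ^ n) / 4 ^+ n.
Definition tate_limit p : R := limn (tate p).

Let dbl_le p : `|h (p + p) - 4 * h p| <= C.
Proof.
have := h_add p p; have := h_dbl p; rewrite subrr ler_norml /C.
have := h_ge0 0; have := ler_norm C1; have := ler_norm C2.
have := normr_ge0 C1; have := normr_ge0 C2.
by move=> *; apply/andP; split; lra.
Qed.

Let tate_step p n : `|tate p n.+1 - tate p n| <= C / 4 ^+ n.+1.
Proof.
have e : p *+ 2 ^ n.+1 = p *+ 2 ^ n + p *+ 2 ^ n by rewrite expnS mul2n -addnn mulrnDr.
rewrite /tate e; set q := p *+ _.
have -> : h (q + q) / 4 ^+ n.+1 - h q / 4 ^+ n = (h (q + q) - 4 * h q) / 4 ^+ n.+1.
  by rewrite exprS; field; rewrite expf_neq0.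
rewrite normrM ler_pM ?dbl_le // ger0_norm // invr_ge0 exprn_ge0 //.
Qed.

Let geo : (fun n => C / 4 ^+ n) @ \oo --> (0 : R).
Proof.
have -> : (fun n => C / 4 ^+ n) = (fun n => C * 4^-1 ^+ n).
  by apply/funext => n; rewrite exprVn.
rewrite -[X in _ --> X](mulr0 C); apply: cvgMr.
by apply: cvg_expr; rewrite ger0_norm ?invr_ge0 // invf_lt1 // ltr1n.
Qed.

Let C_ge0 : 0 <= C. Proof. by rewrite addr_ge0. Qed.

(* Adding or subtracting a multiple of 4^-n that dominates the telescoping error
   makes the sequence monotone; this gives convergence and the distance to h. *)
Let up_nonincr p : nonincreasing_seq (fun n => tate p n + C / 4 ^+ n).
Proof.
apply/nonincreasing_seqP => n; have := tate_step p n; rewrite ler_norml => /andP [_].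
have : C / 4 ^+ n = 4 * (C / 4 ^+ n.+1) by rewrite exprS; field; rewrite expf_neq0.
have : 0 <= C / 4 ^+ n.+1 by rewrite divr_ge0 ?exprn_ge0.
by move=> a -> b; lra.
Qed.

Let low_nondecr p : nondecreasing_seq (fun n => tate p n - C / 4 ^+ n).
Proof.
apply/nondecreasing_seqP => n; have := tate_step p n; rewrite ler_norml => /andP [+ _].
have : C / 4 ^+ n = 4 * (C / 4 ^+ n.+1) by rewrite exprS; field; rewrite expf_neq0.
have : 0 <= C / 4 ^+ n.+1 by rewrite divr_ge0 ?exprn_ge0.
by move=> a -> b; lra.
Qed.

Let up_cvg p : cvgn (fun n => tate p n + C / 4 ^+ n).
Proof.
apply: nonincreasing_is_cvgn; first exact: up_nonincr.
exists 0 => _ [n _ <-]; rewrite addr_ge0 // divr_ge0 ?exprn_ge0 //.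
Qed.

Lemma tate_cvg p : tate p @ \oo --> tate_limit p.
Proof.
suff : cvgn (tate p) by [].
have -> : tate p = (fun n => tate p n + C / 4 ^+ n) \- (fun n => C / 4 ^+ n).
  by apply/funext => n /=; rewrite addrK.
by apply: is_cvgB; [exact: up_cvg|apply/cvg_ex; exists 0; exact: geo].
Qed.

Lemma tate_limit_ge0 p : 0 <= tate_limit p.
Proof.
apply: limr_ge; first by apply/cvg_ex; exists (tate_limit p); exact: tate_cvg.
by apply: nearW => n; rewrite divr_ge0 ?exprn_ge0.
Qed.

Lemma tate_limit_near p : `|tate_limit p - h p| <= C.
Proof.
have up : (fun n => tate p n + C / 4 ^+ n) @ \oo --> tate_limit p.
  by rewrite -[X in _ --> X]addr0; apply: cvgD; [exact: tate_cvg|exact: geo].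
have low : (fun n => tate p n - C / 4 ^+ n) @ \oo --> tate_limit p.
  by rewrite -[X in _ --> X]subr0; apply: cvgB; [exact: tate_cvg|exact: geo].
have t0 : tate p 0 = h p by rewrite /tate expn0 mulr1n expr0 divr1.
rewrite ler_norml; apply/andP; split.
  have := nondecreasing_cvgn_le (low_nondecr p) (cvgP _ low) 0%N.
  by rewrite (cvg_lim (@Rhausdorff R) low) t0 expr0 divr1; lra.
have := nonincreasing_cvgn_ge (up_nonincr p) (cvgP _ up) 0%N.
by rewrite (cvg_lim (@Rhausdorff R) up) t0 expr0 divr1; lra.
Qed.

(* The lower bound comes from [h_add] at p + q and p - q, whose sum and difference
   are the doubles p + p and q + q, followed by [h_dbl]. *)
Let paral_near p q : `|h (p + q) + h (p - q) - 2 * h p - 2 * h q| <= C * 2.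
Proof.
have := h_add p q; have := h_add (p + q) (p - q).
have -> : p + q + (p - q) = p + p by rewrite addrACA subrr addr0.
have -> : p + q - (p - q) = q + q by rewrite opprB addrC addrA subrK.
have := h_dbl p; have := h_dbl q; rewrite ler_norml /C.
have := ler_norm C1; have := ler_norm C2.
have := normr_ge0 C1; have := normr_ge0 C2.
by move=> *; apply/andP; split; lra.
Qed.

Lemma tate_limit_parallelogram p q :
  tate_limit (p + q) + tate_limit (p - q) = 2 * tate_limit p + 2 * tate_limit q.
Proof.
pose w n := tate (p + q) n + tate (p - q) n - 2 * tate p n - 2 * tate q n.
pose D := tate_limit (p + q) + tate_limit (p - q) - 2 * tate_limit p - 2 * tate_limit q.
have wD : w @ \oo --> D.
  apply: cvgB; last by apply: cvgMr; exact: tate_cvg.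
  apply: cvgB; last by apply: cvgMr; exact: tate_cvg.
  by apply: cvgD; exact: tate_cvg.
have w0 : w @ \oo --> (0 : R).
  have g2 : (fun n => C / 4 ^+ n * 2) @ \oo --> (0 : R).
    by rewrite -[X in _ --> X](mul0r 2); apply: cvgMl; exact: geo.
  have g2' : (fun n => - (C / 4 ^+ n * 2)) @ \oo --> (0 : R).
    by rewrite -[X in _ --> X]oppr0; exact: cvgN.
  apply: (squeeze_cvgr _ g2' g2); apply: nearW => n.
  rewrite -ler_norml /w /tate mulrnDl mulrnBl.
  set P := p *+ _; set Q := q *+ _.
  have -> : h (P + Q) / 4 ^+ n + h (P - Q) / 4 ^+ n - 2 * (h P / 4 ^+ n) - 2 * (h Q / 4 ^+ n) = (h (P + Q) + h (P - Q) - 2 * h P - 2 * h Q) / 4 ^+ n by ring.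
  rewrite [X in _ <= X]mulrAC normrM ler_pM ?paral_near //.
  by rewrite ger0_norm // invr_ge0 exprn_ge0.
have : D = 0 by rewrite -(cvg_lim (@Rhausdorff R) wD) (cvg_lim (@Rhausdorff R) w0).
by rewrite /D; lra.
Qed.
End Tate.

Section Parallelogram.
Variables (R : realType) (M : zmodType) (h : M -> R).
Hypothesis para : forall p q, h (p + q) + h (p - q) = 2 * h p + 2 * h q.

Definition polar p q : R := (h (p + q) - h p - h q) / 2.

Lemma para0 : h 0 = 0.
Proof. by have := para 0 0; rewrite addr0 subr0; lra. Qed.

Lemma para_dbl p : h (p + p) = 4 * h p.
Proof. by have := para p p; rewrite subrr para0; lra. Qed.

Lemma polarC p q : polar p q = polar q p.
Proof. by rewrite /polar [p + q]addrC; lra. Qed.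

Lemma polarpp p : polar p p = h p.
Proof. by rewrite /polar para_dbl; lra. Qed.

(** The Jordan-von Neumann argument: four instances of the parallelogram law. *)
Lemma polarDl q : {morph polar^~ q : p r / p + r >-> p + r}.
Proof.
move=> p r; rewrite /polar.
have := para (p + q) r; have := para (p - r) q.
have := para p (q + r); have := para p r.
have -> : p - r + q = p + q - r by rewrite addrAC.
have -> : p - r - q = p - (q + r) by rewrite opprD addrA addrAC.
have -> : p + (q + r) = p + q + r by rewrite addrA.
have -> : p + r + q = p + q + r by rewrite addrAC.
have -> : r + q = q + r by rewrite addrC.
by lra.
Qed.

Lemma polar_sum r (x : 'I_r -> M) (n : 'I_r -> int) q :
  polar (\sum_i x i *~ n i) q = \sum_i (n i)%:~R * polar (x i) q.
Proof.
have fB : zmod_morphism (polar^~ q).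
  by move=> a b; apply: (addIr (polar b q)); rewrite -polarDl !subrK.
pose f : {additive M -> R} := HB.pack (polar^~ q) (GRing.isZmodMorphism.Build M R _ fB).
rewrite -[LHS]/(f _) raddf_sum; apply: eq_bigr => i _.
by rewrite raddfMz mulrzl.
Qed.

Lemma para_sum r (x : 'I_r -> M) (n : 'I_r -> int) :
  h (\sum_i x i *~ n i) = \sum_i \sum_j (n i)%:~R * (n j)%:~R * polar (x i) (x j).
Proof.
rewrite -polarpp polar_sum; apply: eq_bigr => i _.
rewrite polarC polar_sum mulr_sumr; apply: eq_bigr => j _.
by rewrite polarC mulrA.
Qed.

Lemma para_muln p n : h (p *+ n) = n%:R ^+ 2 * h p.
Proof.
have := @para_sum 1 (fun=> p) (fun=> n); rewrite !big_ord1 polarpp expr2.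
by rewrite -[in RHS]pmulrn.
Qed.

(** The pairing with a torsion element and its height vanish since n t = 0 multiplies
    them by n and n^2. *)
Lemma para_torsion p t n : (0 < n)%N -> t *+ n = 0 -> h (p + t) = h p.
Proof.
move=> n0 tn.
have n0' : n%:R != 0 :> R by rewrite pnatr_eq0 -lt0n.
have ht : h t = 0.
  have := para_muln t n; rewrite tn para0 => /esym/eqP.
  by rewrite mulf_eq0 expf_eq0 (negbTE n0') => /eqP.
have p0 : polar 0 p = 0 by rewrite /polar add0r para0; lra.
have pt : polar t p = 0.
  have := @polar_sum 1 (fun=> t) (fun=> n) p; rewrite !big_ord1.
  rewrite -pmulrn tn p0 => /esym/eqP.
  by rewrite mulf_eq0 intr_eq0 -[_ == 0 :> int]/(n == 0)%N (gtn_eqF n0) => /eqP.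
by move: pt; rewrite /polar [t + p]addrC ht => pt; lra.
Qed.
End Parallelogram.

(** * Finiteness and Mordell-Weil coordinates *)

Lemma finite_abs_le (B : int) : finite_set [set n : int | `|n| <= B].
Proof.
have f : finite_set ((fun n : nat => n%:Z) @` `I_(`|B|.+1) `|` (fun n : nat => - n%:Z) @` `I_(`|B|.+1)).
  by rewrite finite_setU; split; apply: finite_image; exact: finite_II.
apply: sub_finite_set f => n /= nB.
have h : (`|n| < `|B|.+1)%N by rewrite ltnS -lez_nat !abszE (le_trans nB) // ler_norm.
by case: (intP n) nB h => [|m|m] nB h; [left; exists 0%N|left; exists m.+1|right; exists m.+1].
Qed.

Section Northcott.
Variable E : elliptic_curve.

Lemma finite_xheight_le (B : int) : finite_set [set p : ec_point E | xheight p <= B].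
Proof.
pose X := [set z : rat | (`|numq z| <= B) /\ (`|denq z| <= B)].
have fX : finite_set X.
  have fP : finite_set ([set n : int | `|n| <= B] `*` [set n : int | `|n| <= B]).
    by apply: finite_setX; exact: finite_abs_le.
  apply: sub_finite_set (finite_image (fun z : int * int => z.1%:~R / z.2%:~R) fP).
  by move=> z [h1 h2]; exists (numq z, denq z) => //=; exact: divq_num_den.
pose Y z := [set p : ec_point E | exists y, val p = Some (z, y)].
have fY z : finite_set (Y z).
  have [[p0 [y0 h0]]|/set0P/negP/negPn/eqP ->] := pselect (Y z !=set0); last exact: finite_set0.
  apply: (@sub_finite_set _ _ [set p0; - p0]); last exact: finite_set2.
  move=> p [y h] /=; have o := valP p; have o0 := valP p0; rewrite h in o; rewrite h0 in o0.
  have [e|e] := same_abscissa o0 o; [left|right]; apply: val_inj; rewrite /= h h0 e //.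
have fU : finite_set ([set 0] `|` \bigcup_(z in X) Y z).
  by rewrite finite_setU; split; [exact: finite_set1|apply: bigcup_finite].
apply: sub_finite_set fU => p /=; rewrite /xheight /xnum /xden ge_max.
case pE : (val p) => [[z y]|] /andP [h1 h2]; last by left; apply: val_inj.
by right; exists z => //; exists y.
Qed.
End Northcott.

Section Height.
Variables (R : realType) (E : elliptic_curve).
Implicit Types p q t : ec_point E.

Let h p : R := weil_height R (ec_x p).

Let h_ge0 p : 0 <= h p.
Proof. by rewrite /h weil_heightE ln_ge0 // ler1z xheight_ge1. Qed.

Let x_gt0 p : 0 < (xheight p)%:~R :> R.
Proof. by rewrite ltr0z (lt_le_trans ltr01) // xheight_ge1. Qed.

Let h_add : exists C1, forall p q, h (p + q) + h (p - q) <= 2 * h p + 2 * h q + C1.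
Proof.
have [c c0 H] := xheight_add_upper E; exists (ln c%:~R) => p q.
have cR : 0 < c%:~R :> R by rewrite ltr0z.
rewrite /h !weil_heightE -lnM ?posrE //.
have -> : 2 * ln (xheight p)%:~R = ln ((xheight p)%:~R ^+ 2) :> R by rewrite lnXn // mulr_natl.
have -> : 2 * ln (xheight q)%:~R = ln ((xheight q)%:~R ^+ 2) :> R by rewrite lnXn // mulr_natl.
rewrite -!lnM ?posrE ?mulr_gt0 ?exprn_gt0 // ler_ln ?posrE ?mulr_gt0 ?exprn_gt0 //.
have := H p q; rewrite -(ler_int R) !intrM ?rmorphXn /= => /le_trans; apply.
by rewrite le_eqVlt; apply/orP; left; apply/eqP; ring.
Qed.

Let h_dbl : exists C2, forall p, 4 * h p <= h (p + p) + C2.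
Proof.
have [c c0 H] := xheight_dbl_lower E; exists (ln c%:~R) => p.
have cR : 0 < c%:~R :> R by rewrite ltr0z.
rewrite /h !weil_heightE -lnM ?posrE //.
have -> : 4 * ln (xheight p)%:~R = ln ((xheight p)%:~R ^+ 4) :> R by rewrite lnXn // mulr_natl.
rewrite ler_ln ?posrE ?mulr_gt0 ?exprn_gt0 //.
by have := H p; rewrite -(ler_int R) rmorphXn intrM /= [leRHS]mulrC.
Qed.

Lemma canonical_heightE p : canonical_height R p = tate_limit h p.
Proof.
rewrite /canonical_height /tate_limit; congr (limn _); apply/funext => n.
by rewrite ec_mulnE.
Qed.

Lemma canonical_height_ge0 p : 0 <= canonical_height R p.
Proof.
have [C1 H1] := h_add; have [C2 H2] := h_dbl.
by rewrite canonical_heightE; exact: (tate_limit_ge0 h_ge0 H1 H2).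
Qed.

Lemma canonical_height_parallelogram p q :
  canonical_height R (p + q) + canonical_height R (p - q) =
  2 * canonical_height R p + 2 * canonical_height R q.
Proof.
have [C1 H1] := h_add; have [C2 H2] := h_dbl.
by rewrite !canonical_heightE; exact: (tate_limit_parallelogram h_ge0 H1 H2).
Qed.

(** The canonical height is within a constant of the Weil height, and only finitely
    many rational abscissae have bounded height. *)
Lemma northcott (B : R) : finite_set [set p : ec_point E | canonical_height R p <= B].
Proof.
have [C1 H1] := h_add; have [C2 H2] := h_dbl.
apply: sub_finite_set (@finite_xheight_le E (Num.ceil (expR (B + `|C1| + `|C2|)))).
move=> p /=; rewrite canonical_heightE => pB.
have := tate_limit_near h_ge0 H1 H2 p; rewrite ler_norml => /andP [l _].
have : h p <= B + `|C1| + `|C2| by lra.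
rewrite /h weil_heightE => l'.
rewrite -(ler_int R); apply: le_trans (ceil_ge _).
by rewrite -[leLHS]lnK ?posrE // ler_expR.
Qed.

Lemma height_pairingE p q : height_pairing R p q = polar (@canonical_height E R) p q.
Proof. by []. Qed.

Section Basis.
Variables (r : nat) (P : 'I_r -> ec_point E).
Hypothesis P_basis : mw_basis P.

Definition gram : 'M[R]_r := \matrix_(i, j) height_pairing R (P i) (P j).

Lemma torsionE t : ec_torsion t -> exists2 n, (0 < n)%N & t *+ n = 0.
Proof. by case=> n n0; rewrite ec_mulnE; exists n. Qed.

Lemma mw_coordP q : mw_eq q (ec_comb P (mw_coord P q)).
Proof. by have [n hn] := P_basis.2 q; apply: (@xgetPex _ 0 [set n | mw_eq q (ec_comb P n)]); exists n. Qed.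

(** Every integer vector is the coordinate vector of a point, so statements about the
    lattice may be checked on points. *)
Lemma mw_coord_comb n : mw_coord P (ec_comb P n) = n.
Proof.
have := mw_coordP (ec_comb P n); set m := mw_coord _ _ => -[k k0 e].
suff /P_basis.1 /eqP : mw_eq (ec_comb P (n - m)) (ec_zero E) by rewrite subr_eq0 => /eqP ->.
exists k => //; rewrite -[RHS]e; congr ec_muln.
rewrite [LHS]ec_addE ec_oppE ec_zeroE subr0 !ec_combE [RHS](_ : _ = \sum_i P i *~ n 0 i - \sum_i P i *~ m 0 i); last by rewrite -!ec_combE.
by rewrite -sumrB; apply: eq_bigr => i _; rewrite !mxE mulrzBr.
Qed.

(** A point differs from the combination of the basis with its coordinates by a
    torsion point, which does not change the height. *)
Lemma canonical_height_qform q : canonical_height R q = qform gram (mw_vec R P q).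
Proof.
have [n n0 e] := torsionE (mw_coordP q).
have := para_torsion canonical_height_parallelogram (ec_comb P (mw_coord P q)) n0 e.
have -> : ec_comb P (mw_coord P q) + ec_add q (ec_opp (ec_comb P (mw_coord P q))) = q.
  by rewrite ec_addE ec_oppE addrC subrK.
move=> ->; rewrite ec_combE (para_sum canonical_height_parallelogram) /qform /bform /mw_vec.
rewrite mxE exchange_big; apply: eq_bigr => j _; rewrite mxE mulr_suml; apply: eq_bigr => i _.
by rewrite !mxE height_pairingE; ring.
Qed.

Lemma gram_sym : gram^T = gram.
Proof. by apply/matrixP => i j; rewrite !mxE !height_pairingE polarC. Qed.

Lemma qform_int_finite (B : R) :
  finite_set [set n : 'rV[int]_r | qform gram (intv R n) <= B].
Proof.
apply: sub_finite_set (finite_image (mw_coord P) (northcott B)) => n /= nB.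
exists (ec_comb P n); last exact: mw_coord_comb.
by rewrite /= canonical_height_qform /mw_vec mw_coord_comb.
Qed.
End Basis.
End Height.

(** * Moments of the Gaussian and the Gamma function *)

Section GaussMoments.
Variable R : realType.
Local Notation mu := (@lebesgue_measure R).
Implicit Types (k n : nat) (x b : R).

(** The absolute value makes the function nonnegative on the whole line, as the
    comparison of integrals over [0, n] with the one over the half-line requires. *)
Definition gmoment k x : R := `|x| ^+ k * expR (- x ^+ 2).

Lemma gmoment_ge0 k x : 0 <= gmoment k x.
Proof. by rewrite mulr_ge0 ?exprn_ge0 ?expR_ge0. Qed.

Lemma continuous_expN2 : continuous (fun x : R => expR (- x ^+ 2)).
Proof. exact: continuous_gauss_fun. Qed.

Lemma continuous_gmoment k : continuous (gmoment k).
Proof.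
move=> x; apply: cvgM; last exact: continuous_expN2.
apply: (@continuous_comp _ _ _ (fun z : R => `|z|) (fun z : R => z ^+ k)).
  exact: (@norm_continuous R R).
exact: exprn_continuous.
Qed.

Lemma measurable_gmoment k : measurable_fun setT (gmoment k).
Proof. apply: continuous_measurable_fun; exact: continuous_gmoment. Qed.

Definition Jint k : \bar R := (\int[mu]_(x in `[0%R, +oo[) (gmoment k x)%:E)%E.
Definition Jcut k b : \bar R := (\int[mu]_(x in `[0%R, b]) (gmoment k x)%:E)%E.

Lemma Jcut_ge0 k b : (0 <= Jcut k b)%E.
Proof. by apply: integral_ge0 => x _; rewrite lee_fin gmoment_ge0. Qed.

Lemma Jcut_cvg k : Jcut k n%:R @[n --> \oo] --> Jint k.
Proof. exact: (ge0_cvgn_integral (gmoment_ge0 k) (measurable_gmoment k)). Qed.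

Lemma Jcut_le k b : (Jcut k b <= Jint k)%E.
Proof.
apply: ge0_subset_integral.
- exact: measurable_itv.
- exact: measurable_itv.
- by apply/measurable_EFinP/measurable_funTS; exact: measurable_gmoment.
- by move=> x _; rewrite lee_fin gmoment_ge0.
by move=> x /=; rewrite !in_itv /= andbT => /andP [].
Qed.

Lemma Jint_integrable k b : mu.-integrable `[0%R, b] (EFin \o gmoment k).
Proof.
apply: continuous_compact_integrable; first exact: segment_compact.
by apply: continuous_subspaceT; exact: continuous_gmoment.
Qed.

Lemma is_derive_expN2 x : is_derive x 1 (fun z : R => expR (- z ^+ 2)) (- (2 * x) * expR (- x ^+ 2)).
Proof.
have h : is_derive x 1 (fun z : R => - z ^+ 2) (- (2 * x)).
  by apply: is_derive_eq; rewrite /GRing.scale /=; ring.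
by apply: is_derive_eq (is_derive1_comp (is_derive_expR _) h) _; rewrite mulrC.
Qed.

Lemma is_derive_mom k x : is_derive x 1 (fun z : R => z ^+ k.+1 * expR (- z ^+ 2))
  ((k.+1%:R * x ^+ k - 2 * x ^+ k.+2) * expR (- x ^+ 2)).
Proof.
have h1 : is_derive x 1 (fun z : R => z ^+ k.+1) (k.+1%:R * x ^+ k).
  have := is_deriveX k.+1 (is_derive_id x (1 : R)); rewrite fctE /GRing.scale /= mulr1.
  exact.
apply: is_derive_eq (is_deriveM h1 (is_derive_expN2 x)) _.
by rewrite /GRing.scale /= !exprS; ring.
Qed.

Lemma continuous_mom k : continuous (fun z : R => z ^+ k * expR (- z ^+ 2)).
Proof. by move=> x; apply: cvgM; [exact: exprn_continuous|exact: continuous_expN2]. Qed.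

(** Integration by parts; the boundary term b^(k+1) exp (- b^2) is nonnegative, and an
    inequality between the truncated integrals is enough to bound the moments. *)
Lemma Jcut_rec k b : 0 < b -> (2%:E * Jcut k.+2 b <= k.+1%:R%:E * Jcut k b)%E.
Proof.
move=> b0; pose f x : R := (k.+1%:R * x ^+ k - 2 * x ^+ k.+2) * expR (- x ^+ 2).
have cf : {within `[0, b], continuous f}.
  apply: continuous_subspaceT => x.
  have -> : f = (fun x => k.+1%:R * (x ^+ k * expR (- x ^+ 2)) - 2 * (x ^+ k.+2 * expR (- x ^+ 2))).
    by apply/funext => y; rewrite /f; ring.
  by apply: cvgB; apply: cvgMr; exact: continuous_mom.
pose F z : R := z ^+ k.+1 * expR (- z ^+ 2).
have dF x : is_derive x 1 F (f x) := is_derive_mom k x.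
have cF : continuous F by exact: continuous_mom.
have fE : (\int[mu]_(x in `[0%R, b]) (f x)%:E)%E = (b ^+ k.+1 * expR (- b ^+ 2))%:E.
  rewrite (@continuous_FTC2 _ f F 0 b b0 cf).
  - by rewrite /F expr0n mul0r sube0.
  - split.
    + by move=> x _; have [] := dF x.
    + exact: cvg_at_right_filter (cF 0).
    + exact: cvg_at_left_filter (cF b).
  by move=> x _; rewrite derive1E; have [_] := dF x.
have fint : mu.-integrable `[0%R, b] (EFin \o f).
  by apply: continuous_compact_integrable => //; exact: segment_compact.
have sc n c : 0 <= c -> (c%:E * Jcut n b = \int[mu]_(x in `[0%R, b]) (c * gmoment n x)%:E)%E.
  move=> c0; rewrite /Jcut -ge0_integralZl_EFin //.
    by move=> x _; rewrite lee_fin gmoment_ge0.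
  by apply/measurable_EFinP/measurable_funTS; exact: measurable_gmoment.
rewrite !sc //.
have -> : (\int[mu]_(x in `[0%R, b]) (k.+1%:R * gmoment k x)%:E =
    \int[mu]_(x in `[0%R, b]) ((EFin \o f) x + (EFin \o (fun x => 2 * gmoment k.+2 x)%R) x))%E.
  apply: eq_integral => x; rewrite inE /= in_itv /= => /andP [x0 _].
  by rewrite -EFinD; congr EFin; rewrite /gmoment ger0_norm // /f; ring.
rewrite integralD //=; first by rewrite fE leeDr // lee_fin mulr_ge0 ?expR_ge0 ?exprn_ge0 // ltW.
exact: integrableZl (Jint_integrable k.+2 b).
Qed.

Lemma Jcut1_le b : 0 < b -> (Jcut 1 b <= 2^-1%:E)%E.
Proof.
move=> b0.
pose F z : R := - 2^-1 * expR (- z ^+ 2).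
have dF x : is_derive x 1 F (x * expR (- x ^+ 2)).
  apply: is_derive_eq (is_deriveZ (- 2^-1) (is_derive_expN2 x)) _.
  by rewrite /GRing.scale /=; field.
have cF : continuous F by move=> x; apply: cvgMr; exact: continuous_expN2.
have -> : Jcut 1 b = (\int[mu]_(x in `[0%R, b]) (x * expR (- x ^+ 2))%:E)%E.
  apply: eq_integral => x; rewrite inE /= in_itv /= => /andP [x0 _].
  by rewrite /gmoment expr1 ger0_norm.
rewrite (@continuous_FTC2 _ _ F 0 b b0).
- by rewrite -EFinB lee_fin /F expr0n oppr0 expR0; have := expR_ge0 (- b ^+ 2); lra.
- apply: continuous_subspaceT => x; have := @continuous_mom 1; exact.
- split.
  + by move=> x _; have [] := dF x.
  + exact: cvg_at_right_filter (cF 0).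
  + exact: cvg_at_left_filter (cF b).
by move=> x _; rewrite derive1E; have [_] := dF x.
Qed.

Lemma Jint0 : Jint 0 = (Num.sqrt pi / 2)%:E.
Proof.
rewrite -integral0y_gauss; apply: eq_integral => x _.
by rewrite /gmoment expr0 mul1r.
Qed.

(** The exact values of the moments: from k to k + 2 they are multiplied by (k + 1) / 2. *)
Fixpoint Jbound k : R :=
  match k with 0 => Num.sqrt pi / 2 | 1 => 2^-1 | k'.+2 => k'.+1%:R / 2 * Jbound k' end.

Lemma Jcut_bound k b : 0 < b -> (Jcut k b <= (Jbound k)%:E)%E.
Proof.
move=> b0; have [m] := ubnP k; elim: m k => // m IH [|[|k]] //= km.
- by rewrite -Jint0 Jcut_le.
- exact: Jcut1_le.
have := Jcut_rec k b0; have := IH k (ltnW km); have := Jcut_ge0 k b; have := Jcut_ge0 k.+2 b.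
case: (Jcut k b) => [u| |]; case: (Jcut k.+2 b) => [v| |] //= v0 u0.
  rewrite -!EFinM !lee_fin => h1 h2; have : k.+1%:R * u <= k.+1%:R * Jbound k by rewrite ler_wpM2l.
  lra.
by rewrite mulry gtr0_sg // mul1e.
Qed.

Lemma Jint_bound k : (Jint k <= (Jbound k)%:E)%E.
Proof.
apply: (cvge_to_le (Jcut_cvg (k := k))); near=> n.
by apply: Jcut_bound; rewrite ltr0n; near: n; exact: nbhs_infty_gt.
Unshelve. all: by end_near. Qed.

Lemma Jint_fin k : Jint k \is a fin_num.
Proof.
rewrite ge0_fin_numE; first exact: le_lt_trans (Jint_bound k) (ltry _).
by apply: integral_ge0 => x _; rewrite lee_fin gmoment_ge0.
Qed.

Definition J k : R := fine (Jint k).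

Lemma J_bound k : J k <= Jbound k.
Proof. by rewrite -lee_fin fineK ?Jint_fin // Jint_bound. Qed.

(** The substitution t = x^2 turns the half-integral power in the Gamma integral into
    an integral one.  It is made on [0, n], where the integrand is continuous once
    the power of exponent r / 2 is written as a power of the square root. *)
Lemma Gamma_J r : (0 < r)%N -> Gamma (r%:R / 2 + 1 : R) = 2 * J r.+1.
Proof.
move=> r0; pose G t : R := Num.sqrt t ^+ r * expR (- t).
have cG : continuous G.
  move=> t; apply: cvgM.
    apply: (@continuous_comp _ _ _ (fun z : R => Num.sqrt z) (fun z : R => z ^+ r)).
      exact: sqrt_continuous.
    exact: exprn_continuous.
  apply: (@continuous_comp _ _ _ (fun z : R => - z) expR); last exact: continuous_expR.
  by apply: cvgN; exact: cvg_id.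
have G0 t : 0 <= G t by rewrite mulr_ge0 ?exprn_ge0 ?sqrtr_ge0 ?expR_ge0.
have mG : measurable_fun setT G by exact: continuous_measurable_fun.
have GE : (\int[mu]_(t in `]0%R, +oo[) (t `^ (r%:R / 2 + 1 - 1) * expR (- t))%:E =
           \int[mu]_(t in `[0%R, +oo[) (G t)%:E)%E.
  rewrite -integral_itv_obnd_cbnd; last exact/measurable_EFinP/measurable_funTS.
  apply: eq_integral => t; rewrite inE /= in_itv /= andbT => t0.
  by rewrite addrK [r%:R / 2]mulrC powRrM powR12_sqrt ?ltW // powR_mulrn // sqrtr_ge0.
have lim1 : (\int[mu]_(t in `[0%R, (n ^ 2)%:R]) (G t)%:E)%E @[n --> \oo] -->
   (\int[mu]_(t in `[0%R, +oo[) (G t)%:E)%E.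
  apply: (@cvg_comp _ _ _ (fun n => n ^ 2)%N (fun n => (\int[mu]_(t in `[0%R, n%:R]) (G t)%:E)%E) \oo \oo).
    apply/cvgnyPge => A; near=> n; apply: (@leq_trans n); first by near: n; exact: nbhs_infty_ge.
    by case: (n) => // m; rewrite -mulnn leq_pmulr.
  exact: ge0_cvgn_integral.
have sub n : (\int[mu]_(t in `[0%R, (n ^ 2)%:R]) (G t)%:E = 2%:E * Jcut r.+1 n%:R)%E.
  have dF : derive1 (fun x : R => x ^+ 2) = (fun x => 2 * x).
    by apply/funext => x; rewrite exp_derive1 /GRing.scale /= expr1.
  have cF' : continuous (fun x : R => 2 * x) by move=> x; apply: cvgMr; exact: cvg_id.
  have := @integration_by_substitution_increasing R (fun x => x ^+ 2) G 0 n%:R.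
  rewrite dF expr0n /= -natrX => ->.
  - rewrite /Jcut -ge0_integralZl_EFin //; last 2 first.
      by move=> x _; rewrite lee_fin gmoment_ge0.
    by apply/measurable_EFinP/measurable_funTS; exact: measurable_gmoment.
    apply: eq_integral => x; rewrite inE /= in_itv /= => /andP [x0 _].
    rewrite -EFinM; congr EFin; rewrite /gmoment.
    change ((Num.sqrt (x ^+ 2) ^+ r * expR (- x ^+ 2)) * (2 * x) =
      2 * (`|x| ^+ r.+1 * expR (- x ^+ 2))).
    by rewrite sqrtr_sqr ger0_norm // [x ^+ r.+1]exprS; ring.
  - by rewrite ler0n.
  - move=> x y; rewrite !in_itv /= => /andP [x0 _] /andP [y0 _] xy.
    by rewrite ltrXn2r.
  - by move=> x _; exact: cF'.
  - by apply/cvg_ex; exists (2 * 0); apply: cvg_at_right_filter; exact: cF'.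
  - by apply/cvg_ex; exists (2 * n%:R); apply: cvg_at_left_filter; exact: cF'.
  - split.
    + by move=> x _; exact: exprn_derivable.
    + by apply: cvg_at_right_filter; exact: exprn_continuous.
    + by apply: cvg_at_left_filter; exact: exprn_continuous.
  - exact: continuous_subspaceT.
have lim2 : (\int[mu]_(t in `[0%R, (n ^ 2)%:R]) (G t)%:E)%E @[n --> \oo] --> (2%:E * Jint r.+1)%E.
  under eq_cvg do rewrite sub.
  by apply: cvgeZl => //; exact: Jcut_cvg.
rewrite /Gamma /Rintegral GE.
rewrite (cvg_unique (@ereal_hausdorff R) lim1 lim2).
by rewrite -[X in (_ * X)%E](fineK (Jint_fin r.+1)) -EFinM.
Unshelve. all: by end_near. Qed.

End GaussMoments.

(** * Gaussian sums over the integers *)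

Section GaussSum.
Variable R : realType.
Local Notation mu := (@lebesgue_measure R).
Implicit Types (x y b c t : R) (m n : nat).

Definition erfint b : R := fine (Jcut 0 b).

Lemma Jcut0_fin b : Jcut 0 b \is a fin_num.
Proof.
rewrite ge0_fin_numE ?Jcut_ge0 //; apply: le_lt_trans (Jcut_le 0 b) _.
by rewrite -ge0_fin_numE ?Jint_fin // (le_trans (Jcut_ge0 0 b)) // Jcut_le.
Qed.

Lemma erfint0 : erfint 0 = 0.
Proof. by rewrite /erfint /Jcut set_itv1 integral_set1. Qed.

Lemma erfint_split x y : 0 <= x -> x <= y ->
  Jcut 0 y = (Jcut 0 x + \int[mu]_(t in `]x, y]) (gmoment 0 t)%:E)%E.
Proof.
move=> x0 xy; rewrite /Jcut -ge0_integral_setU //.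
- congr (integral _ _ _); apply/seteqP; split => t /=; rewrite !in_itv /=.
    by move=> /andP [-> ty] /=; case: (leP t x) => tx; [left|right] => //=; rewrite ?in_itv /= ?tx.
  case=> /andP [u v]; first by rewrite u (le_trans v xy).
  by rewrite v (ltW (le_lt_trans x0 u)).
- by apply/measurable_EFinP/measurable_funTS; exact: measurable_gmoment.
- by move=> t _; rewrite lee_fin gmoment_ge0.
apply/disj_setPS => t /= []; rewrite !in_itv /= => /andP [_ tx] /andP [xt _].
by move: xt; rewrite ltNge tx.
Qed.

Lemma erfint_mono x y : 0 <= x -> x <= y -> erfint x <= erfint y.
Proof.
move=> x0 xy; rewrite -lee_fin !fineK ?Jcut0_fin // (erfint_split x0 xy) leeDl //.
by apply: integral_ge0 => t _; rewrite lee_fin gmoment_ge0.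
Qed.

Lemma erfint_diff x y : 0 <= x -> x <= y ->
  erfint y <= erfint x + (y - x) * expR (- x ^+ 2).
Proof.
move=> x0 xy; rewrite -lee_fin EFinD !fineK ?Jcut0_fin // (erfint_split x0 xy) leeD2l //.
apply: (@le_trans _ _ (\int[mu]_(t in `]x, y]) (expR (- x ^+ 2))%:E)%E).
  apply: ge0_le_integral => //.
  - by move=> t _; rewrite lee_fin gmoment_ge0.
  - by apply/measurable_EFinP/measurable_funTS; exact: measurable_gmoment.
  - move=> t; rewrite /= in_itv /= => /andP [xt _].
    rewrite lee_fin /gmoment expr0 mul1r ler_expR lerN2 lerXn2r ?nnegrE //; last exact: ltW.
    by rewrite (le_trans x0) // ltW.
rewrite integral_cst //= lebesgue_measure_itv /= lte_fin.
case: ltP => xy'; first by rewrite -EFinD -EFinM lee_fin mulrC.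
by rewrite mule0 lee_fin mulr_ge0 ?expR_ge0 // subr_ge0.
Qed.

Lemma erfint_le_id x : 0 <= x -> erfint x <= x.
Proof.
move=> x0; have := erfint_diff (lexx 0) x0.
by rewrite erfint0 add0r subr0 expr0n /= oppr0 expR0 mulr1.
Qed.

Lemma erfint_cvg : erfint n%:R @[n --> \oo] --> (Num.sqrt pi / 2 : R).
Proof.
have := Jcut_cvg (R := R) (k := 0); rewrite Jint0 => h.
exact: (fine_cvg h).
Qed.

(** A decreasing function: each term times b bounds the integral over the interval
    of length b that follows it. *)
Lemma gauss_telescope b t m : 0 < b -> 0 <= t ->
  erfint (b * (t + m%:R)) <= erfint (b * t) + b * \sum_(i < m) expR (- (b * (t + i%:R)) ^+ 2).
Proof.
move=> b0 t0; elim: m => [|m IH]; first by rewrite big_ord0 mulr0 !addr0.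
have p0 : 0 <= b * (t + m%:R) by rewrite mulr_ge0 ?addr_ge0 // ltW.
have := @erfint_diff (b * (t + m%:R)) (b * (t + m.+1%:R)) p0.
rewrite ler_pM2l // lerD2l ler_nat leqnSn => /(_ isT).
rewrite big_ord_recr /= -natr1.
have -> : b * (t + (m%:R + 1)) - b * (t + m%:R) = b by ring.
by move: IH; lra.
Qed.

(** The sum over all integers differs from the integral sqrt pi / b by at most the
    maximum 1 of the function, whatever the shift c.  The number 2 leaves room for the truncation
    to a finite set.  On either side of the centre, at distances t and 1 - t from the
    nearest integers, the sum is compared with an integral; the two missing pieces
    have total length 1. *)
Lemma gauss_sum_lower b c : 0 < b -> exists2 s : seq int, uniq s &
  Num.sqrt pi / b - 2 <= \sum_(n <- s) expR (- (b * (n%:~R + c)) ^+ 2).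
Proof.
move=> b0.
have [m hm] : exists m : nat, Num.sqrt pi / 2 - b / 2 <= erfint (b * m%:R).
  have b2 : 0 < b / 2 by rewrite divr_gt0.
  have /cvgrPdist_le /(_ _ b2) [N _ hN] := erfint_cvg.
  exists (N * (Num.truncn b^-1).+1)%N; apply: (@le_trans _ _ (erfint N%:R)).
    by have := hN N (leqnn N); rewrite ler_norml => /andP [_ h]; lra.
  apply: erfint_mono => //; rewrite natrM mulrCA ler_peMr //.
  by rewrite -ler_pdivrMl // mulr1 ltW // Num.Theory.truncnS_gt.
(* n + c runs through t + i and - (1 - t + i) with i < m *)
pose k := Num.floor c; pose t := c - k%:~R.
have t0 : 0 <= t by rewrite subr_ge0 Num.Theory.floor_le.
have t1 : 0 <= 1 - t.
  by have := Num.Theory.floorD1_gt c; rewrite -/k intrD /t => h; lra.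
pose f1 (i : nat) : int := i%:Z - k; pose f2 (i : nat) : int := - k - 1 - i%:Z.
exists (map f1 (iota 0 m) ++ map f2 (iota 0 m)).
  rewrite cat_uniq !map_inj_uniq ?iota_uniq /=; last 2 first.
  - by move=> i j; rewrite /f2 => /addrI /oppr_inj [].
  - by move=> i j; rewrite /f1 => /addIr [].
  rewrite andbT; apply/hasPn => _ /mapP [i _ ->]; apply/negP => /mapP [j _].
  rewrite /f1 /f2; lia.
rewrite big_cat !big_map /=.
have s1 : \sum_(i <- iota 0 m) expR (- (b * ((f1 i)%:~R + c)) ^+ 2) =
    \sum_(i < m) expR (- (b * (t + i%:R)) ^+ 2).
  rewrite -{1}[m]subn0 -/(index_iota 0 m) big_mkord; apply: eq_bigr => i _.
  by rewrite /f1 /t intrB; congr (expR (- (b * _) ^+ 2)); ring.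
have s2 : \sum_(i <- iota 0 m) expR (- (b * ((f2 i)%:~R + c)) ^+ 2) =
    \sum_(i < m) expR (- (b * (1 - t + i%:R)) ^+ 2).
  rewrite -{1}[m]subn0 -/(index_iota 0 m) big_mkord; apply: eq_bigr => i _.
  have -> : (f2 i)%:~R + c = - (1 - t + i%:R) by rewrite /f2 /t !intrB mulrNz; ring.
  by rewrite mulrN sqrrN.
rewrite s1 s2.
have := gauss_telescope m b0 t0; have := gauss_telescope m b0 t1.
set S2 := \sum_(_ < _) _; set S1 := \sum_(_ < _) _ => h2 h1.
have m1 : erfint (b * m%:R) <= erfint (b * (t + m%:R)).
  by apply: erfint_mono; rewrite ?(ler_pM2l b0) ?lerDr ?mulr_ge0 // ltW.
have m2 : erfint (b * m%:R) <= erfint (b * (1 - t + m%:R)).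
  by apply: erfint_mono; rewrite ?(ler_pM2l b0) ?lerDr ?mulr_ge0 // ltW.
have e1 : erfint (b * t) <= b * t by rewrite erfint_le_id // mulr_ge0 // ltW.
have e2 : erfint (b * (1 - t)) <= b * (1 - t) by rewrite erfint_le_id // mulr_ge0 // ltW.
rewrite -(ler_pM2l b0) mulrBr mulrC divfK ?gt_eqF // mulrDr.
by lra.
Qed.
End GaussSum.

(** * Theta sums and Minkowski's theorem for balls *)

Section Theta.
Variable R : realType.

(** Summing first over the variable that is completed to a square, the inner sum is a
    one-dimensional Gaussian sum, bounded below uniformly in its shift, and the outer
    one is the theta sum of the Schur complement. *)
Lemma theta_lower n (M : 'M[R]_n) : posdef M ->
  exists K d : R, [/\ 0 <= K, 0 < d & forall e, 0 < e -> e < d ->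
    exists2 s : seq 'rV[int]_n, uniq s &
      Num.sqrt pi ^+ n / Num.sqrt (\det M) - K * e <=
        e ^+ n * \sum_(v <- s) expR (- (e ^+ 2 * qform M (intv R v)))].
Proof.
elim: n M => [|n IH] M pM.
  exists 0, 1; split=> // e _ _; exists [:: 0] => //.
  rewrite big_seq1 !expr0 det_mx00 sqrtr1 divr1 mul0r subr0 mul1r.
  by rewrite /qform /bform [intv R 0]thinmx0 !mul0mx mxE mulr0 oppr0 expR0.
have [K' [d' [K0 d0 H]]] := IH _ (schur_posdef pM).
pose a := pivot M; have a0 : 0 < a := pivot_gt0 pM.
have sa0 : 0 < Num.sqrt a by rewrite sqrtr_gt0.
pose A := Num.sqrt pi / Num.sqrt a.
pose B := Num.sqrt pi ^+ n / Num.sqrt (\det (schur M)).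
have A0 : 0 < A by rewrite divr_gt0 // sqrtr_gt0 pi_gt0.
have B0 : 0 <= B by rewrite divr_ge0 ?exprn_ge0 ?sqrtr_ge0.
(* (A - 2 e) (B - K' e) >= A B - (A K' + 2 B) e; the first factor must not be negative *)
exists (A * K' + 2 * B), (Num.min d' (A / 2)); split.
- by rewrite addr_ge0 ?mulr_ge0 // ltW.
- by rewrite lt_min d0 divr_gt0.
move=> e e0; rewrite lt_min => /andP [ed' eA].
have [s us hs] := H e e0 ed'.
pose b := e * Num.sqrt a; have b0 : 0 < b by rewrite mulr_gt0.
pose c (v : 'rV[int]_n) : R := (intv R v *m (offdiag M)^T) 0 0 / a.
have ex v := cid2 (gauss_sum_lower (c v) b0).
pose f v := s2val (ex v).
have uf v : uniq (f v) by exact: s2valP (ex v).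
have hf v : Num.sqrt pi / b - 2 <= \sum_(m <- f v) expR (- (b * (m%:~R + c v)) ^+ 2).
  exact: s2valP' (ex v).
pose join (v : 'rV[int]_n) (m : int) : 'rV[int]_(1 + n) := row_mx m%:M v.
exists [seq join v m | v <- s, m <- f v].
  apply: allpairs_uniq_dep => // -[v m] [v' m'] _ _ /= e1.
  have [/matrixP /(_ 0 0) + ->] : (m%:M = m'%:M :> 'M[int]_1) /\ v = v' := @eq_row_mx _ _ _ _ m%:M v m'%:M v' e1.
  by rewrite !mxE eqxx !mulr1n => ->.
rewrite big_allpairs_dep /=.
have term v m : expR (- (e ^+ 2 * qform M (intv R (join v m)))) =
    expR (- (e ^+ 2 * qform (schur M) (intv R v))) * expR (- (b * (m%:~R + c v)) ^+ 2).
  have -> : intv R (join v m) = row_mx (m%:~R)%:M (intv R v).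
    by rewrite /intv /join map_row_mx map_scalar_mx.
  rewrite (qform_schur pM) -expRD; congr expR.
  rewrite /b -/a -/(c v) !exprMn sqr_sqrtr ?ltW //; ring.
under eq_bigr do (under eq_bigr do rewrite term; rewrite -mulr_sumr).
have eA2 : 0 <= A - 2 * e by lra.
have sum_le : \sum_(v <- s) expR (- (e ^+ 2 * qform (schur M) (intv R v))) * (A / e - 2) <=
  \sum_(v <- s) expR (- (e ^+ 2 * qform (schur M) (intv R v))) *
     \sum_(m <- f v) expR (- (b * (m%:~R + c v)) ^+ 2).
  apply: ler_sum => v _; rewrite ler_wpM2l ?expR_ge0 //.
  apply: le_trans (hf v); rewrite lerD2r /A /b invfM mulrA mulrAC -!mulrA [X in _ <= X]mulrC; lra.
rewrite [e ^+ n.+1]exprS; apply: (@le_trans _ _ ((A - 2 * e) * (B - K' * e))).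
  have -> : Num.sqrt pi ^+ n.+1 / Num.sqrt (\det M) = A * B.
    rewrite (det_schur pM) sqrtrM ?ltW // exprS /A /B invfM; ring.
  have : 0 <= K' * e * e by rewrite !mulr_ge0 // ltW.
  lra.
apply: (@le_trans _ _ ((A - 2 * e) * (e ^+ n * \sum_(v <- s) expR (- (e ^+ 2 * qform (schur M) (intv R v)))))).
  by rewrite ler_wpM2l.
rewrite -mulr_suml in sum_le.
have -> : A - 2 * e = e * (A / e - 2) by field; rewrite gt_eqF.
rewrite -[X in X <= _]mulrA -[X in _ <= X]mulrA ler_pM2l // [X in X <= _]mulrCA ler_pM2l ?exprn_gt0 //.
by rewrite [X in X <= _]mulrC.
Qed.

(** Two vectors of the set congruent modulo N would differ by N k with k integral; by
    the parallelogram law the form at N k is less than 4 x^2 <= N^2, while it is at least N^2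
    unless k = 0.  So reduction modulo N is injective on the set. *)
Lemma count_qform_lt n (M : 'M[R]_n) (s : seq 'rV[int]_n) (x : R) :
    posdef M -> (forall v : 'rV[int]_n, v != 0 -> 1 <= qform M (intv R v)) -> uniq s -> 0 <= x ->
  (count (fun v => qform M (intv R v) < x ^+ 2) s)%:R <= (2 * x + 1) ^+ n.
Proof.
move=> pM min1 us x0.
pose N := `|Num.ceil (2 * x)|%N.
have NE : N%:R = (Num.ceil (2 * x))%:~R :> R.
  rewrite -[RHS]ger0_norm; first by rewrite -intr_norm natr_absz.
  by rewrite ler0z Num.Theory.ceil_ge0; lra.
have xN : 2 * x <= N%:R by rewrite NE Num.Theory.ceil_ge.
have Nx : N%:R <= 2 * x + 1.
  by have := Num.Theory.ceilB1_lt (2 * x); rewrite NE intrB; lra.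
have [N0|Npos] := posnP N.
  have x00 : x = 0 by rewrite N0 in xN; lra.
  rewrite (_ : count _ _ = 0%N) ?exprn_ge0 //; first by lra.
  apply/eqP; rewrite -leqn0 leqNgt -has_count; apply/hasPn => v _.
  by rewrite x00 expr0n -leNgt posdef_ge0.
apply: (@le_trans _ _ (N ^ n)%:R); last by rewrite natrX lerXn2r ?nnegrE //; lra.
rewrite ler_nat.
have Nz : N%:Z != 0 by rewrite eqz_nat -lt0n.
have mod_lt (z : int) : (`|modz z N|%N < N)%N.
  by rewrite -ltz_nat gez0_abs ?modz_ge0 // ltz_pmod.
pose red (v : 'rV[int]_n) : {ffun 'I_n -> 'I_N} :=
  [ffun i => Ordinal (mod_lt (v ord0 i))].
rewrite -size_filter -[X in (_ <= X ^ _)%N]card_ord -[X in (_ <= _ ^ X)%N](card_ord n) -card_ffun.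
rewrite -(size_map red).
set t := map red _; have ut : uniq t; last by rewrite -(card_uniqP ut) max_card.
rewrite map_inj_in_uniq ?filter_uniq // => v w.
rewrite !mem_filter => /andP [hv _] /andP [hw _] e.
apply/eqP; rewrite -subr_eq0; apply/negP => /negP vw.
have dv i : (N %| v ord0 i - w ord0 i)%Z.
  have := congr1 (fun g : {ffun 'I_n -> 'I_N} => val (g i)) e; rewrite !ffunE /= => ei.
  rewrite -eqz_mod_dvd; apply/eqP.
  by rewrite -[LHS]gez0_abs ?modz_ge0 // ei gez0_abs ?modz_ge0.
pose k : 'rV[int]_n := \row_i divz (v ord0 i - w ord0 i) N.
have kE : v - w = N%:Z *: k.
  by apply/rowP => i; rewrite !mxE mulrC divzK.
have k0 : k != 0 by apply: contraNneq vw => k0; rewrite kE k0 scaler0.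
have kR : intv R v - intv R w = N%:R *: intv R k.
  rewrite /intv -map_mxB kE map_mxZ; congr (_ *: _).
have := min1 k k0.
have := qform_sub_le (intv R v) (intv R w) pM.1 (fun u => posdef_ge0 u pM).
rewrite kR qformZ => h1 h2.
have N2 : 0 < N%:R ^+ 2 :> R by rewrite exprn_gt0 // ltr0n.
have h3 : N%:R ^+ 2 <= N%:R ^+ 2 * qform M (intv R k) by rewrite ler_peMr // ltW.
have h4 : (2 * x) ^+ 2 <= N%:R ^+ 2 :> R by rewrite lerXn2r ?nnegrE // mulr_ge0.
by rewrite exprMn in h4; lra.
Qed.

(** Convexity of the n-th power on [a, a + 1]. *)
Lemma expn_chord n (a e : R) : 0 <= a -> 0 <= e -> e <= 1 ->
  (a + e) ^+ n <= (1 - e) * a ^+ n + e * (a + 1) ^+ n.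
Proof.
move=> a0 e0 e1; elim: n => [|n IH]; first by rewrite !expr0; lra.
have ae : 0 <= a + e by rewrite addr_ge0.
have := ler_wpM2l ae IH; rewrite -exprS => /le_trans; apply; rewrite !exprS.
have h : a ^+ n <= (a + 1) ^+ n by rewrite lerXn2r ?nnegrE ?addr_ge0 // lerDl.
have : 0 <= e * (1 - e) * ((a + 1) ^+ n - a ^+ n) by rewrite !mulr_ge0 ?subr_ge0.
lra.
Qed.

Definition Jconst n : R := 3 ^+ n * (2 * J R n.+1 + 2 * J R 1).

Lemma gauss_tail (a : R) : 0 <= a ->
  (\int[@lebesgue_measure R]_(x in `[a, +oo[) (2 * gmoment 1 x)%:E = (expR (- a ^+ 2))%:E)%E.
Proof.
move=> a0; pose F (x : R) : R := - expR (- x ^+ 2).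
have dF (x : R) : is_derive x 1 F (2 * (x * expR (- x ^+ 2))).
  apply: is_derive_eq (is_deriveN (is_derive_expN2 x)) _; ring.
have cF : continuous F by move=> x; apply: cvgN; exact: continuous_expN2.
have -> : (\int[@lebesgue_measure R]_(x in `[a, +oo[) (2 * gmoment 1 x)%:E =
   \int[@lebesgue_measure R]_(x in `[a, +oo[) (2 * (x ^+ 1 * expR (- x ^+ 2)))%:E)%E.
  apply: eq_integral => x; rewrite inE /= in_itv /= andbT => ax.
  by rewrite /gmoment !expr1 ger0_norm // (le_trans a0).
rewrite (@ge0_continuous_FTC2y _ _ F a 0).
- by rewrite -EFinB sub0r opprK.
- by move=> x ax; rewrite !mulr_ge0 ?expR_ge0 // expr1 (le_trans a0).
- by apply: continuous_subspaceT => x; apply: cvgMr; exact: continuous_mom.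
- by rewrite -[X in _ --> X]oppr0; apply: cvgN; exact: cvg_gauss_fun.
- by move=> x _; have [] := dF x.
- exact: cvg_at_right_filter (cF a).
by move=> x _; rewrite derive1E expr1; have [_] := dF x.
Qed.

(** Layer cake: exp (- a^2) is the integral of 2 x exp (- x^2) over x > a, so the sum is
    the integral of 2 x exp (- x^2) against the number of v with qform M v < (x / e)^2. *)
Lemma theta_upper n (M : 'M[R]_n) (s : seq 'rV[int]_n) (e : R) :
    posdef M -> (forall v : 'rV[int]_n, v != 0 -> 1 <= qform M (intv R v)) -> uniq s ->
    0 < e -> e <= 1 ->
  e ^+ n * \sum_(v <- s) expR (- (e ^+ 2 * qform M (intv R v))) <=
    2 ^+ n * (2 * J R n.+1) + e * Jconst n.
Proof.
move=> pM min1 us e0 e1.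
(* f v is the layer of v: it starts at the point where v begins to be counted *)
pose D : set R := [set` `[0 : R, +oo[].
pose r v := e * Num.sqrt (qform M (intv R v)).
have r0 v : 0 <= r v by rewrite mulr_ge0 // ltW.
pose f v (x : R) : \bar R := ((fun x => (2 * gmoment 1 x)%:E) \_ `]r v, +oo[) x.
have f0 v x : (0 <= f v x)%E.
  by rewrite /f patchE; case: ifP => // _; rewrite lee_fin mulr_ge0 // gmoment_ge0.
have mg k (c : R) : measurable_fun setT (fun x => (c * gmoment k x)%:E).
  by apply/measurable_EFinP/measurable_funM => //; exact: measurable_gmoment.
have mf v : measurable_fun D (f v).
  apply: (measurable_funS measurableT) => //.
  by apply/(measurable_restrictT _ _).1; [exact: measurable_itv|exact: measurable_funTS].
have If v : (\int[@lebesgue_measure R]_(x in D) f v x = (expR (- (e ^+ 2 * qform M (intv R v))))%:E)%E.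
  rewrite /f -integral_mkcondr (_ : _ `&` _ = `]r v, +oo[%classic).
    rewrite integral_itv_obnd_cbnd; last exact: measurable_funTS.
    by rewrite gauss_tail // exprMn sqr_sqrtr // posdef_ge0.
  apply/seteqP; split => x /=; rewrite /D /= !in_itv /= !andbT; first by case.
  by move=> h; split=> //; exact: le_trans (r0 v) (ltW h).
have sumE : (\sum_(v <- s) expR (- (e ^+ 2 * qform M (intv R v))))%:E =
    (\int[@lebesgue_measure R]_(x in D) \sum_(v <- s) f v x)%E.
  rewrite ge0_integral_sum //; last exact: measurable_itv.
  by rewrite -sumEFin; apply: eq_bigr => v _; rewrite If.
pose g (x : R) : R := 2 ^+ n * (2 * gmoment n.+1 x) +
  e * (3 ^+ n * (2 * gmoment n.+1 x + 2 * gmoment 1 x)).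
have cnt (x : R) : D x -> (\sum_(v <- s) f v x <= (e ^- n * g x)%:E)%E.
  rewrite /D /= in_itv /= andbT => x0.
  have fE v : f v x = ((if qform M (intv R v) < (x / e) ^+ 2 then 1%N else 0%N)%:R * (2 * gmoment 1 x))%:E.
    rewrite /f patchE mem_setE in_itv /= andbT.
    have -> : (r v < x) = (qform M (intv R v) < (x / e) ^+ 2).
      rewrite /r mulrC -ltr_pdivlMr // -[LHS](@ltr_pXn2r _ 2) ?nnegrE ?divr_ge0 ?(ltW e0) //.
      by rewrite sqr_sqrtr // posdef_ge0.
    by case: ifP; rewrite ?mul1r ?mul0r.
  under eq_bigr do rewrite fE.
  rewrite sumEFin -mulr_suml -natr_sum lee_fin.
  rewrite -big_mkcond /= sum1_count.
  have := count_qform_lt pM min1 us (divr_ge0 x0 (ltW e0)).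
  move: (count _ _) => m hm.
  have g1 : gmoment n.+1 x = x ^+ n * gmoment 1 x.
    by rewrite /gmoment expr1 ger0_norm // exprSr mulrA.
  rewrite /g g1; have := gmoment_ge0 1 x; move: (gmoment 1 x) => y y0.
  apply: (@le_trans _ _ ((2 * (x / e) + 1) ^+ n * (2 * y))); first by rewrite ler_wpM2r // mulr_ge0.
  have en : 0 < e ^+ n by rewrite exprn_gt0.
  rewrite -(ler_pM2l en) mulVKf ?gt_eqF // [X in X <= _]mulrA -exprMn.
  have -> : e * (2 * (x / e) + 1) = 2 * x + e by field; rewrite gt_eqF.
  have conv : (2 * x + e) ^+ n <= 2 ^+ n * x ^+ n + e * (3 ^+ n * (x ^+ n + 1)).
    apply: le_trans (expn_chord n _ (ltW e0) e1) _; first by rewrite mulr_ge0.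
    rewrite exprMn; apply: lerD; first by rewrite ler_piMl ?mulr_ge0 ?exprn_ge0 //; lra.
    rewrite ler_wpM2l ?(ltW e0) //; have [x1|x1] := leP x 1.
      apply: (@le_trans _ _ (3 ^+ n)); first by rewrite lerXn2r ?nnegrE //; lra.
      by rewrite ler_peMr ?exprn_ge0 // lerDr exprn_ge0.
    apply: (@le_trans _ _ ((3 * x) ^+ n)); first by rewrite lerXn2r ?nnegrE //; lra.
    by rewrite exprMn ler_wpM2l ?exprn_ge0 // lerDl.
  by move: conv => /(ler_wpM2r (mulr_ge0 (ler0n _ 2) y0)); lra.
have Jge k : 0 <= J R k.
  by rewrite fine_ge0 // integral_ge0 // => x _; rewrite lee_fin gmoment_ge0.
have JE k : (\int[@lebesgue_measure R]_(x in D) (gmoment k x)%:E = (J R k)%:E)%E.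
  by rewrite fineK ?Jint_fin.
have Jc k c : 0 <= c -> (\int[@lebesgue_measure R]_(x in D) (c * gmoment k x)%:E = (c * J R k)%:E)%E.
  move=> c0; rewrite EFinM -JE -ge0_integralZl_EFin //.
  - exact: measurable_itv.
  - by move=> x _; rewrite lee_fin gmoment_ge0.
  by apply/measurable_EFinP/measurable_funTS; exact: measurable_gmoment.
have gE x : (e ^- n * g x) = (e ^- n * (2 ^+ n * 2 + e * 3 ^+ n * 2)) * gmoment n.+1 x +
    (e ^- n * (e * 3 ^+ n * 2)) * gmoment 1 x by rewrite /g; ring.
have p1 : 0 <= e ^- n * (2 ^+ n * 2 + e * 3 ^+ n * 2).
  by rewrite mulr_ge0 ?invr_ge0 ?exprn_ge0 ?addr_ge0 ?mulr_ge0 ?exprn_ge0 // ltW.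
have p2 : 0 <= e ^- n * (e * 3 ^+ n * 2).
  by rewrite mulr_ge0 ?invr_ge0 ?exprn_ge0 ?mulr_ge0 ?exprn_ge0 // ltW.
have main : ((\sum_(v <- s) expR (- (e ^+ 2 * qform M (intv R v))))%:E <=
    (\int[@lebesgue_measure R]_(x in D) (e ^- n * g x)%:E))%E.
  rewrite sumE; apply: ge0_le_integral => //.
  - exact: measurable_itv.
  - by move=> x _; rewrite sume_ge0.
  - exact: emeasurable_sum.
  - under eq_fun do rewrite gE EFinD.
    by apply: emeasurable_funD; apply: measurable_funTS; exact: mg.
move: main; under eq_integral do rewrite gE EFinD.
rewrite ge0_integralD //; last 5 first.
- exact: measurable_itv.
- by move=> x _; rewrite lee_fin mulr_ge0 // gmoment_ge0.
- by apply: measurable_funTS; exact: mg.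
- by move=> x _; rewrite lee_fin mulr_ge0 // gmoment_ge0.
- by apply: measurable_funTS; exact: mg.
rewrite !Jc // -EFinD lee_fin => main.
have en : 0 < e ^+ n by rewrite exprn_gt0.
rewrite -(ler_pM2l en) in main; apply: le_trans main _.
rewrite le_eqVlt; apply/orP; left; apply/eqP; rewrite /Jconst.
by field; rewrite gt_eqF.
Qed.

(** The volume of the unit ball is sqrt pi ^ n / (2 J (n + 1)); the inequality says that the
    ellipsoid where the form is at most 1 / 4 has volume at most 1. *)
Lemma minkowski_ball n (M : 'M[R]_n) :
    posdef M -> (forall v : 'rV[int]_n, v != 0 -> 1 <= qform M (intv R v)) ->
  Num.sqrt pi ^+ n / Num.sqrt (\det M) <= 2 ^+ n * (2 * J R n.+1).
Proof.
move=> pM min1; have [K [d [K0 d0 H]]] := theta_lower pM.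
apply/ler_addgt0Pr => t t0.
have Jc0 : 0 <= Jconst n.
  by rewrite mulr_ge0 ?exprn_ge0 // addr_ge0 ?mulr_ge0 // fine_ge0 // integral_ge0 // => x _; rewrite lee_fin gmoment_ge0.
pose c := K + Jconst n + 1; have c0 : 0 < c by rewrite ltr_wpDl // addr_ge0.
pose e := Num.min (Num.min (d / 2) 1) (t / c).
have e0 : 0 < e by rewrite !lt_min ltr01 !divr_gt0.
have ed : e < d by rewrite (@le_lt_trans _ _ (d / 2)) ?ge_min ?lexx //; lra.
have e1 : e <= 1 by rewrite !ge_min lexx orbT.
have et : e * c <= t by rewrite -ler_pdivlMr // !ge_min lexx !orbT.
have [s us hs] := H e e0 ed.
have := theta_upper pM min1 us e0 e1.
by rewrite /c in et; move: hs; lra.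
Qed.
End Theta.

(** * Positive definiteness of a discrete form *)

Lemma finite_set_min (T : choiceType) d (U : orderType d) (A : set T) (f : T -> U) :
  finite_set A -> A !=set0 -> exists2 x, A x & forall y, A y -> (f x <= f y)%O.
Proof.
move=> /finite_seqP [s ->] [x0 /= x0s].
elim: s x0 x0s => // a s IH x0 _.
have [->|[b bs]] : s = [::] \/ exists b, b \in s.
  by case: (s) => [|b t]; [left|right; exists b; rewrite inE eqxx].
  by exists a => [|y]; rewrite /= inE // => /eqP ->.
have [x xs hx] := IH b bs.
have [ax|xa] := leP (f a) (f x).
  exists a => [|y]; rewrite /= inE ?eqxx // => /predU1P [-> //|/hx]; exact: le_trans.
exists x => [|y] /=; first by rewrite inE xs orbT.
by rewrite inE => /predU1P [->|/hx //]; exact: ltW.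
Qed.

Lemma finite_set_bound (T : choiceType) (A : set T) (f : T -> nat) :
  finite_set A -> exists B, forall y, A y -> (f y <= B)%N.
Proof.
move=> /finite_seqP [s ->]; exists (\max_(x <- s) f x) => y /= ys.
exact: leq_bigmax_seq.
Qed.

Section Discrete.
Variables (R : realType) (n : nat) (G : 'M[R]_n).
Hypothesis symG : G^T = G.
Hypothesis G_ge0 : forall v : 'rV[int]_n, 0 <= qform G (intv R v).
Hypothesis G_fin : forall B : R, finite_set [set v : 'rV[int]_n | qform G (intv R v) <= B].

Let S : R := \sum_i \sum_j `|G i j|.

Lemma bform_le (u v : 'rV[R]_n) a b : (forall i, `|u 0 i| <= a) -> (forall i, `|v 0 i| <= b) ->
  `|bform G u v| <= a * b * S.
Proof.
move=> ua vb; rewrite /bform mxE (le_trans (ler_norm_sum _ _ _)) // /S mulr_sumr.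
rewrite [leRHS](_ : _ = \sum_j \sum_i a * b * `|G i j|); last first.
  by rewrite exchange_big; apply: eq_bigr => i _; rewrite mulr_sumr.
apply: ler_sum => j _; rewrite normrM !mxE.
have -> : \sum_i a * b * `|G i j| = (\sum_i a * `|G i j|) * b.
  by rewrite mulr_suml; apply: eq_bigr => i _; rewrite mulrAC.
apply: ler_pM => //; apply: le_trans (ler_norm_sum _ _ _) _.
by apply: ler_sum => i _; rewrite normrM ler_wpM2r.
Qed.

Lemma S_ge0 : 0 <= S.
Proof. by apply: sumr_ge0 => i _; apply: sumr_ge0. Qed.

Definition floorv (w : 'rV[R]_n) : 'rV[int]_n := \row_i Num.floor (w 0 i).
Definition fracv (w : 'rV[R]_n) : 'rV[R]_n := w - intv R (floorv w).

Lemma fracv_le1 w i : `|fracv w 0 i| <= 1.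
Proof.
rewrite !mxE ger0_norm ?subr_ge0 ?Num.Theory.floor_le //.
by have := Num.Theory.floorD1_gt (w 0 i); rewrite intrD; lra.
Qed.

(** Write N v = z + f with z integral and f bounded.  Then N^2 q(v) is q(z) >= 0 up to
    an error that is linear in N. *)
Lemma qform_psd (v : 'rV[R]_n) : 0 <= qform G v.
Proof.
pose a := \sum_i `|v 0 i|.
have va i : `|v 0 i| <= a.
  by rewrite /a (bigD1 i) //= lerDl sumr_ge0.
rewrite leNgt; apply/negP => Q0.
pose C := 2 * (a * 1 * S) + 1 * 1 * S.
have C0 : 0 <= C.
  by rewrite addr_ge0 ?mulr_ge0 ?S_ge0 // sumr_ge0.
pose N := (Num.truncn (C / - qform G v)).+1.
have hN : C < N%:R * - qform G v.
  by rewrite -ltr_pdivrMr ?oppr_gt0 // Num.Theory.truncnS_gt.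
have N1 : 1 <= N%:R :> R by rewrite ler1n.
have := G_ge0 (floorv (N%:R *: v)).
have -> : intv R (floorv (N%:R *: v)) = N%:R *: v + (- 1) *: fracv (N%:R *: v).
  by rewrite scaleN1r /fracv opprB addrC subrK.
set f := fracv _; have f1 i : `|f 0 i| <= 1 by exact: fracv_le1.
rewrite (qformD _ _ symG) !qformZ bformZl bformZr.
have := bform_le va f1; have := bform_le f1 f1; rewrite -/(qform G f) !ler_norml.
move=> /andP [q1 q2] /andP [b1 b2].
have h : N%:R * (N%:R * - qform G v) > N%:R * C by rewrite ltr_pM2l // (lt_le_trans ltr01).
have h2 : N%:R * - bform G v f <= N%:R * (a * 1 * S) by rewrite ler_wpM2l //; lra.
have S0 := S_ge0.
have h3 : 1 * S <= N%:R * S by rewrite ler_wpM2r.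
rewrite /C in h; lra.
Qed.

(** Cauchy-Schwarz for a semidefinite form. *)
Lemma qform_kernel v w : qform G v = 0 -> bform G v w = 0.
Proof.
move=> v0; apply/eqP/negPn/negP => b0.
pose q := qform G w; have q0 : 0 <= q := qform_psd w.
pose t := - bform G v w / (q + 1).
have := qform_psd (v + t *: w); rewrite (qformD _ _ symG) v0 add0r bformZr qformZ -/q.
have q1 : 0 < q + 1 by rewrite ltr_wpDl.
have -> : 2 * (t * bform G v w) + t ^+ 2 * q = - (bform G v w ^+ 2 * (q + 2) / (q + 1) ^+ 2).
  by rewrite /t; field; rewrite gt_eqF.
rewrite oppr_ge0 leNgt => /negP; apply.
rewrite divr_gt0 ?exprn_gt0 // mulr_gt0 ?ltr_wpDl //.
by rewrite exprn_even_gt0.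
Qed.

(** If q(v) = 0 with v nonzero, then v is in the kernel of the form, so the integral
    parts of all multiples N v have q bounded; they are infinitely many. *)
Lemma posdef_of_discrete : posdef G.
Proof.
split=> // v v0; rewrite lt_neqAle qform_psd andbT eq_sym; apply/negP => /eqP q0.
have [i vi] : exists i, v 0 i != 0.
  apply/existsP; apply: contraNT v0; rewrite negb_exists => /forallP h.
  by apply/eqP/rowP => i; rewrite mxE; apply/eqP; have := h i; rewrite negbK.
have [B hB] := finite_set_bound (fun z : 'rV[int]_n => `|z ord0 i|%N) (G_fin (1 * 1 * S)).
pose N := (Num.truncn ((B%:R + 1) / `|v 0 i|)).+1.
have hN : B%:R + 1 < N%:R * `|v 0 i|.
  by rewrite -ltr_pdivrMr ?normr_gt0 // Num.Theory.truncnS_gt.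
have e : intv R (floorv (N%:R *: v)) = N%:R *: v + (- 1) *: fracv (N%:R *: v).
  by rewrite scaleN1r /fracv opprB addrC subrK.
have f1 := fracv_le1 (N%:R *: v).
have hz : qform G (intv R (floorv (N%:R *: v))) <= 1 * 1 * S.
  rewrite e (qformD _ _ symG) !qformZ bformZl bformZr q0 (qform_kernel _ q0).
  by rewrite !mulr0 !add0r sqrrN expr1n [leLHS]mul1r (le_trans (ler_norm _)) // /qform bform_le.
have := hB _ hz; rewrite -(ler_nat R) natr_absz intr_norm => h.
have : `|N%:R * v 0 i| <= B%:R + 1.
  have -> : N%:R * v 0 i = (floorv (N%:R *: v) ord0 i)%:~R + fracv (N%:R *: v) 0 i.
    by rewrite /fracv !mxE; ring.
  by rewrite (le_trans (ler_normD _ _)) // lerD.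
by rewrite normrM ger0_norm // leNgt hN.
Qed.
End Discrete.

(** * Minima of a lattice and the determinant *)

Section Minima.
Variables (R : realType) (n : nat) (G : 'M[R]_n).
Hypothesis G_pos : posdef G.
Hypothesis G_fin : forall B : R, finite_set [set v : 'rV[int]_n | qform G (intv R v) <= B].

Definition flag (v : nat -> 'rV[int]_n) (k : nat) : 'M[R]_(k, n) := \matrix_(j < k) intv R (v j).

(** Such a choice realises the successive minima, and in this form, unlike for
    vectors chosen one by one in balls, the lower bound on all vectors outside the
    flag is part of the definition. *)
Definition greedy (v : nat -> 'rV[int]_n) (k : nat) : Prop :=
  ~~ (intv R (v k) <= flag v k)%MS /\
  forall x, ~~ (intv R x <= flag v k)%MS -> qform G (intv R (v k)) <= qform G (intv R x).

Lemma flag_rank_lt v k : (k < n)%N -> exists x : 'rV[int]_n, ~~ (intv R x <= flag v k)%MS.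
Proof.
move=> kn; apply: contrapT => /forallNP h.
have : (1%:M <= flag v k)%MS.
  apply/row_subP => i; have /negP := h (delta_mx 0 i).
  by rewrite negbK row1 /intv map_delta_mx.
move=> /mxrankS; rewrite mxrank1 => /leq_trans /(_ (rank_leq_row _)).
by rewrite leqNgt kn.
Qed.

Lemma greedy_exists : exists v, forall k, (k < n)%N -> greedy v k.
Proof.
suff H m : (m <= n)%N -> exists v, forall k, (k < m)%N -> greedy v k by exact: H.
elim: m => [|m IH] mn; first by exists (fun=> 0).
have [v hv] := IH (ltnW mn).
have [x0 hx0] := flag_rank_lt v mn.
pose A := [set x : 'rV[int]_n | ~~ (intv R x <= flag v m)%MS /\
  qform G (intv R x) <= qform G (intv R x0)].
have fA : finite_set A by apply: sub_finite_set (G_fin (qform G (intv R x0))) => x [].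
have [x [hx xx0] xmin] := finite_set_min (fun x => qform G (intv R x)) fA (ex_intro _ x0 (conj hx0 (lexx _))).
pose w k := if k == m then x else v k.
have wE k : (k <= m)%N -> flag w k = flag v k.
  move=> km; apply/row_matrixP => j; rewrite !rowK /w ltn_eqF //.
  exact: leq_trans (ltn_ord j) km.
exists w => k; rewrite ltnS leq_eqVlt => /predU1P [->|km]; last first.
  by rewrite /greedy wE ?(ltnW km) // /w ltn_eqF //; exact: hv.
rewrite /greedy wE // /w eqxx; split=> // y hy.
have [yx|xy] := leP (qform G (intv R y)) (qform G (intv R x0)); first exact: xmin.
by rewrite (le_trans xx0) // ltW.
Qed.

Section Fixed.
Variable v : nat -> 'rV[int]_n.
Hypothesis hv : forall k, (k < n)%N -> greedy v k.
Local Notation q k := (qform G (intv R (v k))).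

Lemma flagS k : (flag v k.+1 :=: flag v k + intv R (v k))%MS.
Proof.
apply/eqmxP/andP; split.
  apply/row_subP => j; rewrite rowK.
  have [jk|kj] := ltnP j k.
    apply: submx_trans (addsmxSl _ _); have := row_sub (Ordinal jk) (flag v k).
    by rewrite rowK.
  have -> : val j = k by apply/eqP; rewrite eqn_leq kj -ltnS ltn_ord.
  exact: addsmxSr.
rewrite addsmx_sub; apply/andP; split; last first.
  by have := row_sub (@ord_max k) (flag v k.+1); rewrite rowK.
apply/row_subP => j; have := row_sub (widen_ord (leqnSn k) j) (flag v k.+1).
by rewrite !rowK.
Qed.

Lemma flag_mono i j : (i <= j)%N -> (flag v i <= flag v j)%MS.
Proof.
move=> ij; apply/row_subP => k; have := row_sub (widen_ord ij k) (flag v j).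
by rewrite !rowK.
Qed.

Lemma flag_free k : (k <= n)%N -> row_free (flag v k).
Proof.
elim: k => [|k IH] kn; first by rewrite /row_free [flag v 0]flatmx0 mxrank0.
rewrite -row_leq_rank flagS.
have /eqP e := IH (ltnW kn).
rewrite -[X in (X < _)%N]e rank_ltmx // ltmxE addsmxSl /= addsmx_sub negb_and submx_refl /=.
by have [] := hv kn.
Qed.

Lemma greedy_min k x : (k < n)%N -> ~~ (intv R x <= flag v k)%MS -> q k <= qform G (intv R x).
Proof. by move=> kn; have [_] := hv kn; apply. Qed.

Lemma greedy_mono i j : (i <= j)%N -> (j < n)%N -> q i <= q j.
Proof.
move=> ij jn; apply: greedy_min; first exact: leq_ltn_trans ij jn.
have [h _] := hv jn; apply: contra h => /submx_trans; apply; exact: flag_mono.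
Qed.

Lemma greedy_gt0 k : (k < n)%N -> 0 < q k.
Proof.
move=> kn; apply: G_pos.2; have [h _] := hv kn; apply: contraNneq h => ->.
exact: sub0mx.
Qed.

(** They cannot all lie in the span of k vectors. *)
Lemma greedy_indep k (w : 'I_k.+1 -> 'rV[int]_n) : (k < n)%N ->
  row_free (\matrix_(j < k.+1) intv R (w j)) -> exists j, q k <= qform G (intv R (w j)).
Proof.
move=> kn fw; have [[j hj]|h] := pselect (exists j, ~~ (intv R (w j) <= flag v k)%MS).
  by exists j; exact: greedy_min.
have : (\matrix_(j < k.+1) intv R (w j) <= flag v k)%MS.
  apply/row_subP => j; rewrite rowK; apply: contra_notT h => hj; by exists j.
move=> /mxrankS; move/eqP: fw => -> /leq_trans /(_ (rank_leq_row _)).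
by rewrite ltnn.
Qed.

Let V : 'M[R]_n := flag v n.
Let V_unit : V \in unitmx. Proof. by rewrite -row_free_unit flag_free. Qed.

Let Mv := V *m G *m V^T.

Lemma Mv_posdef : posdef Mv. Proof. exact: posdef_congr. Qed.

Lemma Mv_diag (i : 'I_n) : Mv i i = q i.
Proof.
rewrite /qform /bform; have -> : intv R (v i) = row i V by rewrite rowK.
by rewrite -!row_mul tr_row -/Mv !mxE; apply: eq_bigr => j _; rewrite !mxE.
Qed.

Lemma detV_ge1 : 1 <= (\det V) ^+ 2.
Proof.
have VE : V = map_mx intr (\matrix_(j < n) v j) by apply/matrixP => i j; rewrite !mxE.
move: V_unit; rewrite unitmxE unitfE VE det_map_mx /= => d0.
rewrite -rmorphXn /= ler1z -gtz0_ge1 exprn_even_gt0 //=.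
by rewrite -(intr_eq0 R).
Qed.

(** Hadamard's inequality: the Gram-Schmidt vectors are shorter than the v k.  The
    matrix V of the latter has a nonzero integral determinant, so passing from
    the lattice to the one they generate does not decrease the determinant. *)
Lemma det_le_prod : \det G <= \prod_(i < n) q i.
Proof.
have [L [d [tL L1 d0 ME]]] := gram_schmidt Mv_posdef.
have dG : 0 < \det G := posdef_det_gt0 G_pos.
have dM : \det Mv = (\det V) ^+ 2 * \det G.
  by rewrite !det_mulmx det_tr; ring.
apply: (@le_trans _ _ (\det Mv)); first by rewrite dM ler_peMl ?detV_ge1 // ltW.
have dL : \det L = 1 by rewrite det_trig // big1.
rewrite ME !det_mulmx det_tr dL mul1r mulr1 det_diag.
apply: ler_prod => i _; rewrite (ltW (d0 i)) /= -Mv_diag ME.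
rewrite (_ : _ i i = \sum_j L i j ^+ 2 * d 0 j); last first.
  by rewrite mxE; apply: eq_bigr => j _; rewrite mul_mx_diag !mxE; ring.
rewrite (bigD1 i) //= L1 expr1n mul1r lerDl.
by apply: sumr_ge0 => j _; rewrite mulr_ge0 ?sqr_ge0 // ltW.
Qed.

(** Divide the i-th Gram-Schmidt direction of the v k by the i-th minimum.  If k is the
    last direction in which x has a component, then x is outside the span of the
    v i with i < k, so q(x) >= q(v k); and the components of x have been divided by minima
    at most equal to the k-th. *)
Lemma rescaled_form : exists G' : 'M[R]_n,
  [/\ posdef G', \det G' * \prod_(i < n) q i = \det G &
    forall x : 'rV[int]_n, x != 0 -> 1 <= qform G' (intv R x)].
Proof.
have [L [d [tL L1 d0 ME]]] := gram_schmidt Mv_posdef.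
have dL : \det L = 1 by rewrite det_trig // big1.
have L_unit : L \in unitmx by rewrite unitmxE dL unitr1.
pose d' : 'rV[R]_n := \row_i (d 0 i / q i).
pose W := invmx V *m L.
have W_unit : W \in unitmx by rewrite unitmx_mul unitmx_inv V_unit.
have GE : G = W *m diag_mx d *m W^T.
  have -> : W *m diag_mx d *m W^T = invmx V *m Mv *m (invmx V)^T.
    by rewrite ME /W trmx_mul !mulmxA.
  rewrite /Mv !mulmxA mulVmx // mul1mx -mulmxA -trmx_mul mulVmx // trmx1 mulmx1 //.
have qG (x : 'rV[R]_n) (e : 'rV[R]_n) :
    qform (W *m diag_mx e *m W^T) x = \sum_i (x *m W) 0 i ^+ 2 * e 0 i.
  by rewrite qform_congr qform_diag.
exists (W *m diag_mx d' *m W^T); split.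
- apply: posdef_congr => //; apply: posdef_diag => i.
  by rewrite mxE divr_gt0 // greedy_gt0.
- rewrite [in RHS]GE !det_mulmx !det_diag.
  have -> : \prod_i d 0 i = \prod_i d' 0 i * \prod_(i < n) q i; last by ring.
  rewrite -big_split; apply: eq_bigr => i _; rewrite /= [d' 0 i]mxE divfK // gt_eqF //.
  exact: greedy_gt0.
move=> x x0; pose z := intv R x *m W.
have [i0 zi0] : exists i, z 0 i != 0.
  apply/existsP; apply: contraNT x0; rewrite negb_exists => /forallP h.
  have z0 : z = 0 by apply/rowP => i; rewrite [RHS]mxE; apply/eqP; have := h i; rewrite negbK.
  have : intv R x = 0 by rewrite -[LHS](mulmxK W_unit) -/z z0 mul0mx.
  by move=> e; apply/eqP/rowP => i; apply: (@intr_inj R); have /rowP /(_ i) := e; rewrite !mxE.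
case: (@arg_maxnP _ i0 (fun i => z 0 i != 0) val zi0) => k zk kmax.
have xk : ~~ (intv R x <= flag v k)%MS.
  apply: contra zk => /submxP [c cE].
  pose E : 'M[R]_(k, n) := \matrix_(j, i) (val i == val j)%:R.
  have fE : flag v k = E *m V.
    apply/row_matrixP => j; rewrite rowK row_mul.
    have jn : (j < n)%N by exact: ltn_trans (ltn_ord j) (ltn_ord k).
    have -> : row j E = delta_mx 0 (Ordinal jn).
      by apply/rowP => i; rewrite !mxE eqxx.
    by rewrite -rowE rowK.
  rewrite /z cE fE /W !mulmxA mulmxK // mxE big1 // => i _.
  have [ik|ki] := ltnP i k; first by rewrite (is_trig_mxP tL) // mulr0.
  rewrite mxE big1 ?mul0r // => j _; rewrite !mxE.
  by rewrite gtn_eqF ?mulr0 // (leq_trans (ltn_ord j)).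
have qk0 := greedy_gt0 (ltn_ord k).
have qxE : qform G (intv R x) = \sum_i z 0 i ^+ 2 * d 0 i by rewrite {1}GE qG.
have := greedy_min (ltn_ord k) xk; rewrite qxE => qx.
rewrite qG -/z; apply: (@le_trans _ _ (\sum_i z 0 i ^+ 2 * d 0 i / q k)).
  by rewrite -mulr_suml ler_pdivlMr // mul1r.
apply: ler_sum => i _; rewrite [d' 0 i]mxE -mulrA.
have [->|zi] := eqVneq (z 0 i) 0; first by rewrite expr0n /= !mul0r.
rewrite ler_wpM2l ?sqr_ge0 // ler_wpM2l ?(ltW (d0 i)) // lef_pV2 ?posrE ?greedy_gt0 //.
by apply: greedy_mono => //; exact: kmax.
Qed.
End Fixed.
End Minima.

(** * The volume of the ball *)

Section BallVolume.
Variable R : realType.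

(** This is 2^r <= r! kappa_r, the comparison of the ball with the inscribed
    cross-polytope.  From r to r + 2 the right-hand side grows faster since
    (r + 1) pi >= 2, and there is equality for r = 0 and r = 1. *)
Lemma Jbound_upper r : 2 ^+ r * (2 * Jbound R r.+1) <= r`!%:R * Num.sqrt pi ^+ r.
Proof.
have p2 : 2 <= pi :> R := pi_ge2 R.
have sp0 : 0 <= Num.sqrt pi :> R by exact: sqrtr_ge0.
have [m] := ubnP r; elim: m r => // m IH [|[|r]] rm.
- by rewrite /= !expr0 fact0; lra.
- rewrite [Jbound R 2]/= /= !expr1 factS fact0; lra.
have {}IH := IH r (ltnW rm).
rewrite [Jbound R r.+3]/= -/(Jbound R r.+1) !factS !exprS !natrM.
have spE : Num.sqrt pi * Num.sqrt pi = pi :> R by rewrite -expr2 sqr_sqrtr // pi_ge0.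
apply: (@le_trans _ _ (2 * r.+2%:R * (2 ^+ r * (2 * Jbound R r.+1)))).
  by rewrite le_eqVlt; apply/orP; left; apply/eqP; field.
apply: (@le_trans _ _ (2 * r.+2%:R * (r`!%:R * Num.sqrt pi ^+ r))).
  by rewrite ler_wpM2l // mulr_ge0.
have -> : r.+2%:R * (r.+1%:R * r`!%:R) * (Num.sqrt pi * (Num.sqrt pi * Num.sqrt pi ^+ r)) =
  (r.+1%:R * pi) * r.+2%:R * (r`!%:R * Num.sqrt pi ^+ r) :> R.
  by move: (Num.sqrt pi) spE => sp <-; ring.
rewrite ler_wpM2r ?mulr_ge0 ?exprn_ge0 // ler_wpM2r //.
by rewrite (le_trans p2) // ler_peMl ?pi_ge0 // ler1n.
Qed.

Lemma ball_volumeE r : (0 < r)%N -> ball_volume R r = Num.sqrt pi ^+ r / (2 * J R r.+1).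
Proof.
move=> r0; rewrite /ball_volume Gamma_J //; congr (_ / _).
by rewrite [_ / 2]mulrC powRrM powR12_sqrt ?pi_ge0 // powR_mulrn // sqrtr_ge0.
Qed.
End BallVolume.

(** * Successive minima of the Mordell-Weil lattice *)

Section SuccessiveMinima.
Variables (R : realType) (E : elliptic_curve) (r : nat) (P : 'I_r -> ec_point E).
Hypothesis P_basis : mw_basis P.
Local Notation G := (gram R P).

Lemma gram_posdef : posdef G.
Proof.
apply: posdef_of_discrete; first exact: gram_sym.
  move=> v; rewrite -[v](mw_coord_comb P_basis) -(canonical_height_qform R P_basis).
  exact: canonical_height_ge0.
exact: qform_int_finite.
Qed.

Variable v : nat -> 'rV[int]_r.
Hypothesis hv : forall k, (k < r)%N -> greedy G v k.

(** The ball of radius sqrt (q v_k) contains v_0, ..., v_k, and by [greedy_indep] no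
    smaller ball contains k + 1 independent vectors. *)
Lemma successive_minimumE k : (k < r)%N ->
  successive_minimum R P k.+1 = Num.sqrt (qform G (intv R (v k))).
Proof.
move=> kr; rewrite /successive_minimum; set A := [set l' | ball_has_indep P k.+1 l'].
set l := Num.sqrt _.
have Al : is_least A l.
  split.
    exists (fun j : 'I_k.+1 => ec_comb P (v j)); split.
      move=> j; rewrite /mw_norm ler_wsqrtr // (canonical_height_qform R P_basis).
      rewrite /mw_vec mw_coord_comb //; apply: (greedy_mono hv) => //.
      by rewrite -ltnS ltn_ord.
    have -> : \matrix_(j < k.+1) mw_vec R P (ec_comb P (v j)) = flag R v k.+1.
      by apply/row_matrixP => j; rewrite !rowK /mw_vec mw_coord_comb.
    exact: (flag_free hv).
  move=> l' [Q [Ql Qfree]].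
  have [j hj] := greedy_indep hv (w := fun j => mw_coord P (Q j)) kr Qfree.
  apply: le_trans (Ql j); rewrite /mw_norm ler_wsqrtr //.
  by rewrite (canonical_height_qform R P_basis).
have [Al1 Al2] : is_least A (xget 0 [set l | is_least A l]) by exact: (@xgetPex _ 0 [set l | is_least A l] (ex_intro _ l Al)).
by apply/le_anti/andP; split; [exact: Al2 Al.1|exact: Al.2 Al1].
Qed.
End SuccessiveMinima.

Lemma regulatorE (R : realType) (E : elliptic_curve) r (P : 'I_r -> ec_point E) :
  regulator R P = \det (gram R P).
Proof. by []. Qed.

Theorem corollary6p3 (R : realType) (E : elliptic_curve) (r : nat)
    (r_gt0 : (0 < r)%N) (P : 'I_r -> ec_point E) (P_basis : mw_basis P) :
  let lambda (i : 'I_r) : R := successive_minimum R P i.+1 in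
  let kappa : R := ball_volume R r in
  let Reg : R := regulator R P in
  (2 ^+ r / (r`!%:R * kappa) * Num.sqrt Reg <= \prod_(i < r) lambda i
     /\ \prod_(i < r) lambda i <= 2 ^+ r / kappa * Num.sqrt Reg)
  /\
  ((kappa / 2 ^+ r) ^+ 2 * \prod_(i < r) lambda i ^+ 2 <= Reg
     /\ Reg <= (r`!%:R * kappa / 2 ^+ r) ^+ 2 * \prod_(i < r) lambda i ^+ 2).
Proof.
move=> lambda kappa Reg.
have G_pos : posdef (gram R P) := gram_posdef R P_basis.
have G_fin (B : R) := qform_int_finite P_basis B.
have [v hv] := greedy_exists G_fin.
pose q k := qform (gram R P) (intv R (v k)).
have q_gt0 (i : 'I_r) : 0 < q i by exact: (greedy_gt0 G_pos hv).
have lambdaE i : lambda i = Num.sqrt (q i) by exact: (successive_minimumE P_basis hv).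
have lambda_gt0 i : 0 < lambda i by rewrite lambdaE sqrtr_gt0.
pose L := \prod_(i < r) lambda i.
have L_gt0 : 0 < L by exact: prodr_gt0.
have L2 : \prod_(i < r) q i = L ^+ 2.
  by rewrite /L -prodrXl; apply: eq_bigr => i _; rewrite lambdaE sqr_sqrtr // ltW.
have Reg_gt0 : 0 < Reg := posdef_det_gt0 G_pos.
pose S := Num.sqrt Reg; have S_gt0 : 0 < S by rewrite sqrtr_gt0.
have S2 : S ^+ 2 = Reg by rewrite sqr_sqrtr // ltW.
have SL : S <= L.
  rewrite -(@ler_pXn2r _ 2) ?nnegrE ?(ltW S_gt0) ?(ltW L_gt0) // S2 -L2.
  exact: (det_le_prod G_pos hv).
have [G' [G'_pos detG' minG']] := rescaled_form G_pos hv.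
have d'0 := posdef_det_gt0 G'_pos.
have S' : Num.sqrt (\det G') * L = S.
  by rewrite /S /Reg regulatorE -detG' L2 sqrtrM ?ltW // sqrtr_sqr gtr0_norm.
have s'0 : 0 < Num.sqrt (\det G') by rewrite sqrtr_gt0.
pose s := Num.sqrt pi ^+ r : R; pose g := 2 * J R r.+1.
have s0 : 0 < s by rewrite exprn_gt0 // sqrtr_gt0 pi_gt0.
have mink : s / Num.sqrt (\det G') <= 2 ^+ r * g := minkowski_ball G'_pos minG'.
have p2 : 0 < 2 ^+ r :> R by rewrite exprn_gt0.
have g0 : 0 < g by rewrite -(pmulr_rgt0 _ p2) (lt_le_trans _ mink) // divr_gt0.
have kE : kappa = s / g := ball_volumeE R r_gt0.
have k0 : 0 < kappa by rewrite kE divr_gt0.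
have f0 : 0 < r`!%:R :> R by rewrite ltr0n fact_gt0.
have cross : 2 ^+ r <= r`!%:R * kappa.
  rewrite kE mulrA ler_pdivlMr //; apply: le_trans (Jbound_upper R r).
  by rewrite ler_wpM2l ?(ltW p2) // ler_wpM2l // J_bound.
have up : kappa * L <= 2 ^+ r * S.
  rewrite -S' mulrA ler_wpM2r ?(ltW L_gt0) // kE ler_pdivrMr //.
  by rewrite mulrAC -ler_pdivrMr.
have low : 2 ^+ r * S <= r`!%:R * kappa * L.
  by rewrite ler_pM // ?mulr_ge0 ?ltW.
have -> : \prod_(i < r) lambda i ^+ 2 = L ^+ 2 by rewrite prodrXl.
clearbody kappa; rewrite -/L -/S -S2; split; split.
- by rewrite mulrAC ler_pdivrMr ?[L * _]mulrC // mulr_gt0.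
- by rewrite mulrAC ler_pdivlMr // mulrC.
- rewrite -exprMn ler_pXn2r ?nnegrE ?mulr_ge0 ?invr_ge0 ?(ltW k0) ?(ltW p2) ?(ltW L_gt0) ?(ltW S_gt0) //.
  by rewrite mulrAC ler_pdivrMr // [S * _]mulrC.
rewrite -exprMn ler_pXn2r ?nnegrE ?mulr_ge0 ?invr_ge0 ?(ltW k0) ?(ltW p2) ?(ltW L_gt0) ?(ltW S_gt0) //.
by rewrite mulrAC ler_pdivlMr // mulrC.
Qed.
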